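(* Let $\beta>0$ and let $-A$ be the generator of a polynomially stable $C_0$-semigroup with parameter $\beta$ on a Hilbert space $H$. Then, for all $q\in(0,1/2)$, there exists $M>0$ such that $$\|f(A)A^{-\beta q}\|\le\|A^{-\beta q}\|\,|f(\infty)|+M\|f\|_{\mathcal{B}_0,q}$$ for all $f\in\mathcal{B}$.
   Context: Hilbert spaces are complex; $\mathbb{C}_+ := \{z\in\mathbb{C}:\operatorname{Re}z>0\}$. A $C_0$-semigroup $(e^{-tA})_{t\ge 0}$ with generator $-A$ is polynomially stable with parameter $\beta>0$ if $\sup_{t\ge 0}\|e^{-tA}\|<\infty$ and $\|e^{-tA}(I+A)^{-1}\| = O(t^{-1/\beta})$ as $t\to\infty$; it is known that then $A$ has a bounded inverse, and $A^{-\beta q}$ is the (bounded) fractional power. $\mathcal{B}$ is the algebra of holomorphic functions $f$ on $\mathbb{C}_+$ such that $\|f\|_{\mathcal{B}_0} := \int_0^\infty\sup_{\eta\in\mathbb{R}}|f'(\xi+i\eta)|\,d\xi<\infty$. For $f\in\mathcal{B}$ the limit $f(\infty) := \lim_{\operatorname{Re}z\to\infty}f(z)$ exists in $\mathbb{C}$. For $-A$ the generator of a bounded $C_0$-semigroup on $H$ and $f\in\mathcal{B}$, the bounded operator $f(A)$ (the $\mathcal{B}$-calculus) is defined by $$\langle f(A)x,y\rangle := \langle f(\infty)x,y\rangle-\frac{2}{\pi}\int_0^\infty\xi\int_{-\infty}^\infty\langle(\xi-i\eta+A)^{-2}x,y\rangle f'(\xi+i\eta)\,d\eta\,d\xi,\quad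 x,y\in H,$$ where the integral is absolutely convergent. For $q>0$ and $f\in\mathcal{B}$, $$\|f\|_{\mathcal{B}_0,q} := \int_0^\infty\psi_q(\xi)\sup_{\eta\in\mathbb{R}}|f'(\xi+i\eta)|\,d\xi,$$ where $\psi_q(\xi) := \xi^q$ for $0<\xi<1$ and $\psi_q(\xi) := 1$ for $\xi\ge1$. *)

(* Defs.v *)
From HB Require Import structures.
From mathcomp Require Import all_boot all_order all_algebra.
From mathcomp Require Import all_classical all_reals all_analysis.
From mathcomp Require Import sesquilinear complex.
Import Order.TTheory GRing.Theory Num.Theory.
Import numFieldNormedType.Exports.

Set Implicit Arguments.
Unset Strict Implicit.
Unset Printing Implicit Defensive.

Local Open Scope classical_set_scope.
Local Open Scope ring_scope.
Local Open Scope complex_scope.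

(* The norm of a normed space over R[i] takes its values in R[i], in the
   nonnegative real axis; [rnorm] is the same norm with values in R. *)
Definition rnorm (R : realType) (V : normedModType R[i]) (x : V) : R :=
  complex.Re `|x|.

Definition cintegral (R : realType) (D : set R) (g : R -> R[i]) : R[i] :=
  (\int[lebesgue_measure]_(t in D) complex.Re (g t))
  +i* (\int[lebesgue_measure]_(t in D) complex.Im (g t)).

(* Elements of the algebra B are represented by total functions; only
   the values on the open right half-plane matter.  Since R[i]^o is R[i] seen
   as a normed space over itself, [derivable] and [derive1] below refer to the
   complex derivative. *)

Section BAlgebra.
Variable R : realType.
Implicit Types (f : R[i]^o -> R[i]^o) (q xi : R).

Definition holomorphic_rhp f : Prop :=
  forall z : R[i], 0 < complex.Re z -> derivable f z 1.

Definition sup_deriv f xi : \bar R :=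
  ereal_sup (range (fun eta : R => (rnorm (derive1 f (xi +i* eta)))%:E)).

Definition normB0 f : \bar R :=
  (\int[lebesgue_measure]_(xi in `]0%R, +oo[) sup_deriv f xi)%E.

Definition in_B f : Prop := holomorphic_rhp f /\ (normB0 f < +oo)%E.

Definition psi q xi : R := if xi < 1 then xi `^ q else 1.

Definition normB0q q f : \bar R :=
  (\int[lebesgue_measure]_(xi in `]0%R, +oo[)
     ((psi q xi)%:E * sup_deriv f xi))%E.

Definition Re_pinfty : set_system R[i] :=
  filter_from [set: R] (fun M => [set z : R[i] | M < complex.Re z]).

Definition f_infty f : R[i]^o := lim (f z @[z --> Re_pinfty]).

End BAlgebra.

(* An operator with domain; the values of [op_fun] outside [op_dom] are
   irrelevant. *)
Record unbounded_op (H : Type) := UnboundedOp {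
  op_dom : set H ;
  op_fun :> H -> H }.

Section Operators.
Variables (R : realType) (H : completeNormedModType R[i]).
Implicit Types (A G : unbounded_op H) (B : H -> H) (T : R -> {linear H -> H}).

Definition opp_op A : unbounded_op H :=
  UnboundedOp (op_dom A) (fun x => - A x).

Definition add_scalar_op (z : R[i]) A : unbounded_op H :=
  UnboundedOp (op_dom A) (fun x => z *: x + A x).

(* The inverse of A, when A maps its domain bijectively onto H. *)
Definition inv_op A : H -> H :=
  fun y => xget 0 [set x | op_dom A x /\ A x = y].

(* (z + A)^-1; note the sign convention. *)
Definition res (z : R[i]) A : H -> H := inv_op (add_scalar_op z A).

Definition opnorm B : \bar R :=
  ereal_sup [set (rnorm (B x))%:E | x in [set x : H | `|x| <= 1]].

(* T is only meaningful at nonnegative times. *)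
Definition C0_semigroup T : Prop :=
  [/\ forall t : R, 0 <= t -> continuous (T t),
      forall x, T 0 x = x,
      forall (s t : R) x, 0 <= s -> 0 <= t -> T (s + t) x = T s (T t x)
    & forall x, T t x @[t --> 0^'+] --> x].

(* The equivalence determines both the domain of G and its values there. *)
Definition generator T G : Prop :=
  forall x y, (op_dom G x /\ G x = y) <->
    (h^-1)%:C *: (T h x - x) @[h --> 0^'+] --> y.

Definition polynomially_stable (beta : R) T A : Prop :=
  (ereal_sup [set opnorm (T t) | t in [set t : R | (0 <= t)%R]] < +oo)%E /\
  exists K : R, \forall t \near +oo,
    (opnorm (T t \o res 1%R A) <= (K * t `^ (- beta^-1))%R%:E)%E.

End Operators.

Section FunctionalCalculus.
Variables (R : realType) (H : completeNormedModType R[i]).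
Variable ip : {dot H for @conjc R}.
Implicit Types (A : unbounded_op H) (f : R[i]^o -> R[i]^o).

(* The vector representing phi, which exists uniquely when phi is a bounded
   conjugate-linear form on a Hilbert space with inner product ip. *)
Definition riesz (phi : H -> R[i]) : H :=
  xget 0 [set u | forall y, ip u y = phi y].

Definition Bcalc f A (x : H) : H :=
  riesz (fun y => ip (f_infty f *: x) y
    - (2 / pi)%:C * cintegral `]0, +oo[ (fun xi =>
        xi%:C * cintegral setT (fun eta =>
          ip (res (xi -i* eta) A (res (xi -i* eta) A x)) y
          * derive1 f (xi +i* eta)))).

(* Balakrishnan's formula, for 0 < theta < 1:
     A^-theta = sin(pi theta) / pi int_0^oo s^-theta (s + A)^-1 ds. *)
Definition balakrishnan theta A (x : H) : H :=
  riesz (fun y => (sin (pi * theta) / pi)%:C *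
    cintegral `]0, +oo[ (fun s => (s `^ (- theta))%:C * ip (res s%:C A x) y)).

(* A^-alpha for alpha >= 0, as (A^-1)^n A^-(alpha - n) with n the integer part
   of alpha. *)
Definition neg_power (alpha : R) A (x : H) : H :=
  let n := Num.truncn alpha in
  let theta := alpha - n%:R in
  iter n (inv_op A) (if theta == 0 then x else balakrishnan theta A x).

End FunctionalCalculus.

(* Main.v *)
(* The kernel estimate
     xi * int_R |<(xi - i eta + A)^-2 u, y>| d eta <= M psi_q(xi) |x| |y|
   for u = A^(-beta q) x gives the theorem at once.  It follows from the decay
   |T(t) u| <= C (1 + t)^-q |x|, which makes int_0^oo e^(-2 xi t) |T(t) u|^2 dt
   of order psi_q(xi)^2 / xi because 2 q < 1.

   Plancherel's theorem for vector-valued functions and adjoint semigroups are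
   avoided by working with the frequencies eta_k = sigma + 2 pi k / P, where P is
   so large that |e^(-xi P) T(P)| <= 1 / 2.  Up to a factor 2, the resolvents
   R_k = (xi - i eta_k + A)^-1 are then integrals of e^(-xi t) e^(i eta_k t) T(t)
   over [0, P], where the characters e^(i eta_k t) are orthogonal.  By duality this
   bounds both sum_k |R_k u|^2 and |sum_k R_k c_k|, hence sum_k |<R_k R_k u, y>|;
   integrating over sigma gives the integral over the line.

   The decay of T(t) u follows from |T(t) A^-1| = O(t^(-1/beta)), iterated for the
   integral powers of A^-1 and inserted in Balakrishnan's formula for the
   fractional part.  Time integrals are handled by comparing the increments of
   functions t |-> <T(t) v, y> with those of explicit primitives. *)

Require Import Defs.
From HB Require Import structures.
From mathcomp Require Import all_boot all_order all_algebra.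
From mathcomp Require Import all_classical all_reals all_analysis.
From mathcomp Require Import sesquilinear complex.
From mathcomp Require Import ring lra measurable_realfun.
Import Order.TTheory GRing.Theory Num.Theory.
Import numFieldNormedType.Exports.

Set Implicit Arguments.
Unset Strict Implicit.
Unset Printing Implicit Defensive.

Local Open Scope classical_set_scope.
Local Open Scope ring_scope.
Local Open Scope complex_scope.

(** All resolvent estimates rest on one encoding. [right_deriv S v w] says that the generator of [S]
    sends [v] to [w]. Since S(t) = e^(-z t) T(t) has generator -(z + A), the equation (z + A) v = x
    becomes [right_deriv S v (- x)], and v - S(P) v is then the weak integral of S(t) x over [0, P].
    The bound on sum_k |<R_k R_k u, y>| carries a factor P, which the frequency spacing 2 pi / P
    cancels when the sum becomes an integral; so the final constant does not see how P depends on
    xi. The other free parameter, the weight in Young's inequality for the dual bound, is set to a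
    multiple of psi_q(xi): the two terms are then of orders psi_q / xi and (psi_q^2 / xi) / psi_q,
    which agree. Values obtained by choice default to 0: the estimates for [inv_op], [balakrishnan]
    and [Bcalc] treat that value as a separate, trivial case. *)

Section ComplexModulus.
Variable R : realType.

Lemma ReD (z w : R[i]) :
  complex.Re (z + w) = complex.Re z + complex.Re w.
Proof. by case: z; case: w. Qed.

Lemma ReN (z : R[i]) : complex.Re (- z) = - complex.Re z.
Proof. by case: z. Qed.

Lemma ReM_real (a : R) (z : R[i]) : complex.Re (a%:C * z) = a * complex.Re z.
Proof. by case: z => u v /=; rewrite mul0r subr0. Qed.

Lemma Re_norm_ge0 (z : R[i]) : 0 <= complex.Re `|z|.
Proof. by rewrite normc_def /= sqrtr_ge0. Qed.

Lemma Re_le_norm (z : R[i]) : `|complex.Re z| <= complex.Re `|z|.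
Proof. by have := normc_ge_Re z; rewrite lecE => /andP[]. Qed.

Lemma Re_normr_le (z : R[i]) : complex.Re `|z| <= `|complex.Re z| + `|complex.Im z|.
Proof.
case: z => a b; rewrite normc_def /=.
rewrite -(@ler_pXn2r _ 2) ?nnegrE ?sqrtr_ge0 ?addr_ge0 //.
rewrite sqr_sqrtr ?addr_ge0 ?sqr_ge0 // sqrrD !real_normK ?num_real //.
by rewrite lerD2r lerDl mulrn_wge0 ?mulr_ge0.
Qed.

Lemma Re_normM (z w : R[i]) : complex.Re `|z * w| = complex.Re `|z| * complex.Re `|w|.
Proof. by rewrite normrM !normc_def /= mul0r subr0. Qed.

Lemma Re_normrM (a : R) (z : R[i]) : complex.Re `|a%:C * z| = `|a| * complex.Re `|z|.
Proof.
by rewrite normrM !normc_def /= expr0n /= addr0 sqrtr_sqr mul0r subr0.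
Qed.

Lemma Re_normD (z w : R[i]) :
  complex.Re `|z + w| <= complex.Re `|z| + complex.Re `|w|.
Proof. by rewrite -ReD; have := ler_normD z w; rewrite lecE => /andP[]. Qed.

Lemma Re_cintegral (D : set R) (g : R -> R[i]) :
  complex.Re (cintegral D g) = \int[lebesgue_measure]_(t in D) complex.Re (g t).
Proof. by []. Qed.

End ComplexModulus.

(** * The real part of the inner product, completeness and Riesz representation *)

Section RealInnerProduct.
Variables (R : realType) (H : completeNormedModType R[i]).
Variable ip : {dot H for @conjc R}.
Hypothesis ip_norm : forall x : H, `|x| ^+ 2 = ip x x.
Implicit Types (x y : H) (a : R) (z : R[i]).

Definition rip x y : R := complex.Re (ip x y).

Lemma ripDl x x' y : rip (x + x') y = rip x y + rip x' y.
Proof. by rewrite /rip linearDl ReD. Qed.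

Lemma ripC x y : rip x y = rip y x.
Proof. by rewrite /rip hermC /= expr0 mul1r; case: (ip y x). Qed.

Lemma ripDr x y y' : rip x (y + y') = rip x y + rip x y'.
Proof. by rewrite ripC ripDl !(ripC x). Qed.

Lemma ripZl a x y : rip (a%:C *: x) y = a * rip x y.
Proof.
rewrite /rip linearZl_LR /=; case: (ip x y) => u v /=.
by rewrite mul0r subr0.
Qed.

Lemma ripZr a x y : rip x (a%:C *: y) = a * rip x y.
Proof. by rewrite ripC ripZl ripC. Qed.

Lemma rip_conj z x y : rip (z *: x) y = rip x (z^*%C *: y).
Proof. by rewrite /rip linearZl_LR linearZr_LR /= conjcK. Qed.

Lemma ripNl x y : rip (- x) y = - rip x y.
Proof. by rewrite -mulN1r -ripZl rmorphN1 scaleN1r. Qed.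

Lemma ripNr x y : rip x (- y) = - rip x y.
Proof. by rewrite ripC ripNl ripC. Qed.

Lemma ripBl x x' y : rip (x - x') y = rip x y - rip x' y.
Proof. by rewrite ripDl ripNl. Qed.

Lemma ripBr x y y' : rip x (y - y') = rip x y - rip x y'.
Proof. by rewrite ripDr ripNr. Qed.

Lemma rip0l y : rip 0 y = 0.
Proof. by rewrite -(subrr (0 : H)) ripBl subrr. Qed.

Lemma rip0r y : rip y 0 = 0.
Proof. by rewrite ripC rip0l. Qed.

Lemma rip_suml (I : Type) (r : seq I) (F : I -> H) y :
  rip (\sum_(i <- r) F i) y = \sum_(i <- r) rip (F i) y.
Proof. by apply: (big_morph (rip^~ y)) => [u v|]; rewrite ?ripDl ?rip0l. Qed.

Lemma rip_sumr (I : Type) (r : seq I) (F : I -> H) y :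
  rip y (\sum_(i <- r) F i) = \sum_(i <- r) rip y (F i).
Proof. by apply: (big_morph (rip y)) => [u v|]; rewrite ?ripDr ?rip0r. Qed.

Lemma normr_rnorm x : `|x| = (rnorm x)%:C.
Proof. by rewrite /rnorm RRe_real // ger0_real. Qed.

Lemma rnorm_ge0 x : 0 <= rnorm x.
Proof. by rewrite -ler0c -normr_rnorm. Qed.

Lemma rnorm0 : rnorm (0 : H) = 0.
Proof. by rewrite /rnorm normr0. Qed.

Lemma rnormD x y : rnorm (x + y) <= rnorm x + rnorm y.
Proof. by rewrite -lecR rmorphD /= -!normr_rnorm ler_normD. Qed.

Lemma rnormN x : rnorm (- x) = rnorm x.
Proof. by rewrite /rnorm normrN. Qed.

Lemma rnormC x y : rnorm (x - y) = rnorm (y - x).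
Proof. by rewrite -rnormN opprB. Qed.

Lemma rnormB x y : rnorm (x - y) <= rnorm x + rnorm y.
Proof. by rewrite -[rnorm y]rnormN rnormD. Qed.

Lemma rnorm_tri x y w : rnorm (x - w) <= rnorm (x - y) + rnorm (y - w).
Proof. by rewrite -[x in x - w](subrK y) -addrA rnormD. Qed.

Lemma rnormZ z x : rnorm (z *: x) = complex.Re `|z| * rnorm x.
Proof.
by rewrite {1}/rnorm normrZ normc_def (normr_rnorm x) /= mulr0 subr0.
Qed.

Lemma rnormZr a x : rnorm (a%:C *: x) = `|a| * rnorm x.
Proof. by rewrite rnormZ normc_def /= expr0n /= addr0 sqrtr_sqr. Qed.

Lemma rip_norm x : rip x x = rnorm x ^+ 2.
Proof. by apply: complexI; rewrite /rip -ip_norm normr_rnorm -rmorphXn /=. Qed.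

Lemma rnorm_eq0 x : rnorm x = 0 -> x = 0.
Proof. by move=> x0; apply/eqP; rewrite -normr_eq0 normr_rnorm x0. Qed.

Lemma rip_CauchySchwarz x y : `|rip x y| <= rnorm x * rnorm y.
Proof.
have [y0|yN0] := eqVneq (rnorm y) 0.
  by rewrite (rnorm_eq0 y0) rip0r normr0 rnorm0 mulr0.
have y0 : 0 < rnorm y by rewrite lt_neqAle eq_sym yN0 rnorm_ge0.
rewrite -(@ler_pXn2r _ 2) ?nnegrE ?mulr_ge0 ?rnorm_ge0 //.
rewrite real_normK ?num_real // exprMn -!rip_norm.
pose c := rip x y / rip y y.
have yy0 : 0 < rip y y by rewrite rip_norm exprn_gt0.
have : 0 <= rip (x - c%:C *: y) (x - c%:C *: y) by rewrite rip_norm sqr_ge0.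
rewrite ripBl !ripBr !ripZl !ripZr (ripC y x) => h.
have : 0 <= rip y y * (rip x x - c * rip x y - (c * rip x y - c * (c * rip y y))).
  exact: mulr_ge0 (ltW _) h.
have -> : rip y y * (rip x x - c * rip x y - (c * rip x y - c * (c * rip y y)))
  = rip x x * rip y y - rip x y ^+ 2.
  by rewrite /c; field; rewrite gt_eqF.
by rewrite subr_ge0.
Qed.

Lemma rip_le x y : rip x y <= rnorm x * rnorm y.
Proof. exact: le_trans (ler_norm _) (rip_CauchySchwarz _ _). Qed.

Lemma rip_ext x x' : (forall y, rip x y = rip x' y) -> x = x'.
Proof.
move=> e; apply/eqP; rewrite -subr_eq0; apply/eqP/rnorm_eq0.
apply/eqP; rewrite -sqrf_eq0 -rip_norm; apply/eqP.
by rewrite ripBl e subrr.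
Qed.

Lemma rnorm_le_rip x c : 0 <= c -> (forall y, rip x y <= c * rnorm y) -> rnorm x <= c.
Proof.
move=> c0 /(_ x); rewrite rip_norm expr2 => h.
have [->//|/eqP xN0] := eqVneq (rnorm x) 0.
have x0 : 0 < rnorm x by rewrite lt_neqAle rnorm_ge0 eq_sym; apply/andP; split; [apply/eqP|].
by rewrite -(ler_pM2r x0).
Qed.

End RealInnerProduct.

Section Completeness.
Variables (R : realType) (H : completeNormedModType R[i]).
Implicit Types (x y : H).

Lemma posc_real (e : R[i]) : 0 < e -> exists2 a : R, 0 < a & e = a%:C.
Proof.
case: e => a b; rewrite ltcE /= => /andP[/eqP -> a0]; by exists a.
Qed.

Lemma cvg_rnormP {I : Type} (F : set_system I) {FF : Filter F} (f : I -> H) (l : H) :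
  f t @[t --> F] --> l <->
  forall e : R, 0 < e -> \forall t \near F, rnorm (f t - l) < e.
Proof.
split=> [/cvgrPdist_lt h e e0|h].
  have e0' : 0 < e%:C by rewrite ltcR.
  apply: filterS (h _ e0') => t; rewrite distrC.
  by rewrite normr_rnorm ltcR.
apply/cvgrPdist_lt => e /posc_real[a a0 ->].
by apply: filterS (h _ a0) => t; rewrite distrC normr_rnorm ltcR.
Qed.

Lemma rnorm_complete (u : nat -> H) :
  (forall e : R, 0 < e -> exists n, forall m k, (n <= m)%N -> (n <= k)%N ->
     rnorm (u m - u k) < e) ->
  exists l, forall e : R, 0 < e -> \forall n \near \oo, rnorm (u n - l) < e.
Proof.
move=> uC.
have : cvg (u @ \oo).
  apply/cauchy_cvgP/cauchyP => e /posc_real[a a0 ->].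
  have [n hn] := uC _ a0.
  exists (u n); exists n => // m /= nm.
  by rewrite -ball_normE /ball_ /= normr_rnorm ltcR hn.
by move=> /cvg_rnormP h; exists (lim (u @ \oo)).
Qed.

End Completeness.

Section Riesz.
Variables (R : realType) (H : completeNormedModType R[i]).
Variable ip : {dot H for @conjc R}.
Hypothesis ip_norm : forall x : H, `|x| ^+ 2 = ip x x.
Local Notation rip := (rip ip).

Lemma parallelogram (x y : H) :
  rnorm (x + y) ^+ 2 + rnorm (x - y) ^+ 2 = 2 * rnorm x ^+ 2 + 2 * rnorm y ^+ 2.
Proof.
rewrite -!(rip_norm ip_norm) !ripDl !ripDr !ripNl !ripNr; ring.
Qed.

(* Minimize the functional J(u) = |u|^2 - 2 phi(u); by the parallelogram law
   every minimizing sequence is Cauchy. *)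
Lemma riesz_representation (phi : H -> R) (C : R) :
  (forall x y, phi (x + y) = phi x + phi y) ->
  (forall (a : R) x, phi (a%:C *: x) = a * phi x) ->
  (forall x, phi x <= C * rnorm x) ->
  exists u, forall y, rip u y = phi y.
Proof.
move=> phiD phiZ phiC.
pose J u := rnorm u ^+ 2 - 2 * phi u.
have Jlb u : - C ^+ 2 <= J u.
  have := phiC u; have := sqr_ge0 (rnorm u - C); rewrite /J sqrrB => h1 h2; nra.
pose S := range J.
have SI : has_inf S.
  split; first by exists (J 0), 0.
  by exists (- C ^+ 2) => _ [u _ <-].
pose I0 := inf S.
have Jge u : I0 <= J u by apply: ge_inf; [exact: (proj2 SI)|exists u].
have /choice[u hu] : forall n : nat, exists u, J u < I0 + n.+1%:R^-1.
  move=> n; have [_ [u _ <-] hu] := @inf_adherent _ S n.+1%:R^-1 ltac:(by []) SI.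
  by exists u.
(* The parallelogram law, with [I0] a lower bound for [J] at the midpoint of [x] and [y]. *)
have JB x y : rnorm (x - y) ^+ 2 <= 2 * (J x - I0) + 2 * (J y - I0).
  have := parallelogram x y.
  have := Jge ((2^-1 : R)%:C *: (x + y)).
  rewrite /J phiZ phiD rnormZr exprMn real_normK ?num_real //.
  move=> h1 h2; nra.
have uC : forall e : R, 0 < e -> exists n, forall m k, (n <= m)%N -> (n <= k)%N ->
     rnorm (u m - u k) < e.
  move=> e e0.
  have e4 : 0 < e ^+ 2 / 4 by rewrite divr_gt0 ?exprn_gt0.
  have [n hn] : exists n : nat, n.+1%:R^-1 < e ^+ 2 / 4.
    have [n _ /(_ n (leqnn n))] := near_infty_natSinv_lt (PosNum e4).
    by exists n.
  have inv_le m : (n <= m)%N -> m.+1%:R^-1 <= n.+1%:R^-1 :> R.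
    by move=> nm; rewrite lef_pV2 ?posrE ?ler_nat.
  exists n => m k nm nk.
  rewrite -(@ltr_pXn2r _ 2) ?nnegrE ?rnorm_ge0 ?(ltW e0) //.
  apply: le_lt_trans (JB _ _) _.
  have := hu m; have := hu k; 
  have := le_lt_trans (inv_le _ nm) hn; have := le_lt_trans (inv_le _ nk) hn.
  move: (J (u m)) (J (u k)) (m.+1%:R^-1) (k.+1%:R^-1) => a b c d; lra.
have [l hl] := rnorm_complete uC.
have Jl : J l <= I0.
  apply/ler_addgt0Pr => e e0.
  (* In [J l - J (u n)] the quadratic term is nonpositive and the linear ones are at most 2 |l| + 2
     |C| times the distance; the extra 1 makes [D] positive, so that one can divide by it. *)
  pose D := 2 * rnorm l + 1 + 2 * `|C|.
  have D0 : 0 < D by rewrite /D; have := rnorm_ge0 l; have := normr_ge0 C; lra.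
  pose d := Num.min 1 (e / 2 / D).
  have d0 : 0 < d by rewrite lt_min ltr01 /= !divr_gt0.
  have e2 : 0 < e / 2 by rewrite divr_gt0.
  near \oo => n.
  have h1 : rnorm (u n - l) < d by near: n; exact: hl.
  have h2 : n.+1%:R^-1 < e / 2.
    by near: n; exact: (near_infty_natSinv_lt (PosNum e2)).
  have h3 : J (u n) < I0 + e / 2 by apply: lt_trans (hu n) _; rewrite ltrD2l.
  clear h2.
  have hd1 : d <= 1 by rewrite /d ge_min lexx.
  have hd2 : d * D <= e / 2 by rewrite -ler_pdivlMr // /d ge_min lexx orbT.
  suff : J l <= J (u n) + d * D by lra.
  have -> : J (u n) = J l + 2 * rip l (u n - l) + rnorm (u n - l) ^+ 2 - 2 * phi (u n - l).
    have e1 : u n = l + (u n - l) by rewrite addrC subrK.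
    rewrite /J {1 2}e1 phiD -!(rip_norm ip_norm) ripDl !ripDr (ripC _ (u n - l) l); ring.
  have h4 := rip_CauchySchwarz ip_norm l (u n - l).
  have h5 := phiC (u n - l).
  have h6 : C <= `|C| := ler_norm C.
  have h7 := rnorm_ge0 (u n - l).
  have h8 := rnorm_ge0 l.
  have h9 : - rip l (u n - l) <= rnorm l * rnorm (u n - l).
    by apply: le_trans h4; rewrite -normrN ler_norm.
  have h10 : rnorm l * rnorm (u n - l) <= rnorm l * d by rewrite ler_wpM2l // ltW.
  have h11 : C * rnorm (u n - l) <= `|C| * d.
    by apply: le_trans (ler_wpM2r h7 h6) _; rewrite ler_wpM2l // ltW.
  have h12 : 0 <= rnorm (u n - l) ^+ 2 by exact: sqr_ge0.
  rewrite /D; nra.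
exists l => y.
have key (t : R) : 0 <= t ^+ 2 * rnorm y ^+ 2 + 2 * t * (rip l y - phi y).
  have := le_trans Jl (Jge (l + t%:C *: y)).
  rewrite /J phiD phiZ -!(rip_norm ip_norm) ripDl !ripDr !ripZl !ripZr (ripC _ y l).
  lra.
apply/eqP; rewrite -subr_eq0; apply/eqP; move: key.
set b := rip l y - phi y; set a := rnorm y ^+ 2 => key.
have a0 : 0 <= a by exact: sqr_ge0.
(* This [t] makes the quadratic in [key] negative unless [b = 0]; [a + 1] replaces the denominator
   [a] of the minimizer, which vanishes for [y = 0]. *)
have := key (- b / (a + 1)).
have -> : (- b / (a + 1)) ^+ 2 * a + 2 * (- b / (a + 1)) * b
   = - (b ^+ 2 * (a + 2) / (a + 1) ^+ 2) by field; rewrite gt_eqF //; lra.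
rewrite oppr_ge0 => h.
have h2 : b ^+ 2 * (a + 2) <= 0.
  move: h; rewrite pmulr_lle0 // invr_gt0 exprn_gt0 //; lra.
have : b ^+ 2 <= 0 by move: h2; rewrite pmulr_lle0 //; lra.
by rewrite le_eqVlt ltNge sqr_ge0 orbF sqrf_eq0 => /eqP.
Unshelve. all: by end_near.
Qed.

(* The adjoint is taken with respect to the real inner product, which for
   complex-linear operators gives the usual one. *)
Lemma adjoint_exists (B : H -> H) (C : R) :
  (forall x y, B (x + y) = B x + B y) ->
  (forall (a : R) x, B (a%:C *: x) = a%:C *: B x) ->
  (forall x, rnorm (B x) <= C * rnorm x) ->
  forall y, exists u, forall x, rip (B x) y = rip x u.
Proof.
move=> BD BZ BC y.
have [||x|u hu] := @riesz_representation (fun x => rip (B x) y) (C * rnorm y).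
- by move=> x x'; rewrite BD ripDl.
- by move=> a x; rewrite BZ ripZl.
- apply: le_trans (rip_le ip_norm _ _) _.
  by rewrite mulrAC ler_wpM2r ?rnorm_ge0.
by exists u => x; rewrite (ripC _ x) hu.
Qed.

End Riesz.

(** * Comparison of increments of real functions *)

Section ScalarCalculus.
Variable R : realType.
Implicit Types (f g df dg c : R -> R) (a b t : R).

Lemma increment_le f g df dg a b : a <= b ->
  (forall t, a <= t <= b -> {for t, continuous f}) ->
  (forall t, a <= t <= b -> {for t, continuous g}) ->
  (forall t, a < t < b -> is_derive t 1 f (df t)) ->
  (forall t, a < t < b -> is_derive t 1 g (dg t)) ->
  (forall t, a < t < b -> df t <= dg t) ->
  f b - f a <= g b - g a.
Proof.
move=> ab cf cg Df Dg dfg.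
have Dh t : a < t < b -> is_derive t 1 (g - f) (dg t - df t).
  by move=> /[dup] /Df ? /Dg ?; exact: is_deriveB.
suff : (g - f) a <= (g - f) b.
  rewrite -![(g - f) _]/(g _ - f _); lra.
apply: (@ger0_derive1_ndecr _ _ a b) => //.
- by move=> t; rewrite in_itv /= => /Dh[].
- move=> t; rewrite in_itv /= => abt.
  by have ? := Dh _ abt; rewrite derive1E derive_val subr_ge0 dfg.
- apply: continuous_in_subspaceT => t /set_mem /=; rewrite in_itv /= => tab.
  by apply: cvgB; [exact: cg|exact: cf].
Qed.

Lemma increment_eq f g df a b : a <= b ->
  (forall t, a <= t <= b -> {for t, continuous f}) ->
  (forall t, a <= t <= b -> {for t, continuous g}) ->
  (forall t, a < t < b -> is_derive t 1 f (df t)) ->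
  (forall t, a < t < b -> is_derive t 1 g (df t)) ->
  f b - f a = g b - g a.
Proof.
move=> ab cf cg Df Dg; apply/eqP; rewrite eq_le; apply/andP; split.
  exact: (@increment_le f g df df).
exact: (@increment_le g f df df).
Qed.

Lemma is_derive_continuous f (d : R) t : is_derive t 1 f d -> {for t, continuous f}.
Proof. by case=> /derivable1_diffP /differentiable_continuous. Qed.

Lemma primitive_exists c a : continuous c ->
  exists F, forall t, a < t -> is_derive t 1 F (c t).
Proof.
move=> cc; exists (fun x => (\int[lebesgue_measure]_(t in [set` `[a, x]]) (c t))%R).
move=> t at_.
have [] := @continuous_FTC1_closed _ c a t (t + 1) _ _ at_ (cc t).
- by rewrite ltrDl.
- apply: continuous_compact_integrable; first exact: segment_compact.
  exact: continuous_subspaceT.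
- by move=> d e; split => //; rewrite -derive1E.
Qed.

Lemma is_derive1P f (df : R) t :
  (forall e, 0 < e -> \forall h \near 0, `|f (t + h) - f t - h * df| <= e * `|h|) ->
  is_derive t 1 f df.
Proof.
move=> hf.
suff cv : h^-1 *: ((f \o shift t) (h *: (1 : R)) - f t) @[h --> 0^'] --> df.
  by split; [apply/cvg_ex; exists df|exact: cvg_lim].
apply/cvgrPdist_le => e e0.
have [d /= d0 hd] := hf e e0.
exists d => //= h /hd hh h0.
rewrite /shift /= distrC (_ : h^-1 *: _ - df = h^-1 * (f (t + h) - f t - h * df)).
  by rewrite normrM normfV ler_pdivrMl ?normr_gt0 // (mulrC _ e).
by rewrite mulrBr mulKf // /GRing.scale /= mulr1 (addrC h).
Qed.

End ScalarCalculus.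

(** * Bounded semigroups and their generators *)

Section BoundedSemigroup.
Variables (R : realType) (H : completeNormedModType R[i]).
Variable ip : {dot H for @conjc R}.
Hypothesis ip_norm : forall x : H, `|x| ^+ 2 = ip x x.
Local Notation rip := (rip ip).

(* Only nonnegative times matter; extending the family evenly makes its orbits
   continuous on the whole line. *)
Record even_semigroup (S : R -> H -> H) (K : R) : Prop := EvenSemigroup {
  esgD : forall t x y, S t (x + y) = S t x + S t y ;
  esgZ : forall t (a : R) x, S t (a%:C *: x) = a%:C *: S t x ;
  esg0 : forall x, S 0 x = x ;
  esg_add : forall s t x, 0 <= s -> 0 <= t -> S (s + t) x = S s (S t x) ;
  esg_bound : forall t x, rnorm (S t x) <= K * rnorm x ;
  esg_abs : forall t x, S `|t| x = S t x ;
  esg_cvg0 : forall x (e : R), 0 < e -> \forall h \near 0^'+, rnorm (S h x - x) <= e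
}.

(** The pair [(v, w)] lies in the graph of the generator of [S]. The difference quotient is
    multiplied out by [h], so that the bound passes directly through operators and inner
    products. *)
Definition right_deriv (S : R -> H -> H) (v w : H) : Prop :=
  forall e : R, 0 < e -> \forall h \near 0^'+, rnorm (S h v - v - h%:C *: w) <= e * h.

Variables (S : R -> H -> H) (K : R).
Hypotheses (SK : even_semigroup S K) (K1 : 1 <= K).

Let K0 : 0 < K. Proof. exact: lt_le_trans K1. Qed.

Lemma esgN t x : S t (- x) = - S t x.
Proof. by rewrite -[- x]scaleN1r -[- S t x]scaleN1r -(rmorphN1 (real_complex R)) (esgZ SK). Qed.

Lemma esgB t x y : S t (x - y) = S t x - S t y.
Proof. by rewrite (esgD SK) esgN. Qed.

Lemma at_right_exists (Q : R -> Prop) :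
  (\forall h \near 0^'+, Q h) -> exists2 d : R, 0 < d & forall h, 0 < h -> h < d -> Q h.
Proof.
move=> [d /= d0 hd]; exists d => // h h0 hd'.
by apply: hd => //=; rewrite sub0r normrN gtr0_norm.
Qed.

(** By the semigroup law an increment from [a] to [b] is [S a] applied to the increment from 0 to
    [b - a], so strong continuity at 0 yields a modulus independent of the base point. *)
Lemma esg_modulus x (e : R) : 0 < e -> exists2 d : R, 0 < d &
  forall s t, `|s - t| < d -> rnorm (S s x - S t x) <= e.
Proof.
move=> e0; have e0' : 0 < e / K by rewrite divr_gt0.
have [d d0 hd] := at_right_exists (esg_cvg0 SK x e0').
exists d => // s t st.
have main a b : 0 <= a -> a <= b -> b - a < d -> rnorm (S b x - S a x) <= e.
  move=> a0 ab bad.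
  have -> : b = a + (b - a) by rewrite addrC subrK.
  rewrite (esg_add SK) ?subr_ge0 // -esgB.
  apply: le_trans (esg_bound SK _ _) _.
  rewrite -ler_pdivlMl // mulrC.
  have [->|ba] := eqVneq b a; first by rewrite subrr (esg0 SK) subrr rnorm0 ltW.
  by rewrite hd // subr_gt0 lt_neqAle eq_sym ba.
rewrite -(esg_abs SK s) -(esg_abs SK t).
have h : `| `|s| - `|t| | < d by apply: le_lt_trans st; exact: ler_dist_dist.
have [ts|/ltW ts] := leP `|t| `|s|.
  by apply: main => //; apply: le_lt_trans h; exact: ler_norm.
rewrite rnormC; apply: main => //.
by apply: le_lt_trans h; rewrite distrC ler_norm.
Qed.

Lemma esg_rip_continuous x y : continuous (fun t => rip (S t x) y).
Proof.
move=> t; apply/cvgrPdist_le => e e0.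
have e0' : 0 < e / (rnorm y + 1) by rewrite divr_gt0 // ltr_wpDl ?rnorm_ge0.
have [d d0 hd] := esg_modulus x e0'.
exists d => // s /= ts.
rewrite -ripBl; apply: le_trans (rip_CauchySchwarz ip_norm _ _) _.
apply: le_trans (ler_wpM2r (rnorm_ge0 _) (hd _ _ ts)) _.
rewrite -mulrA ler_piMr ?(ltW e0) // mulrC ler_pdivrMr ?ltr_wpDl ?rnorm_ge0 //.
by rewrite mul1r lerDl.
Qed.

(** A right derivative at time 0 gives a two-sided one at [t]: a backward increment of size [k] is
    [S (t - k)] applied to [S k v - v], and [S (t - k) w] is then replaced by [S t w] through the
    uniform modulus. *)
Lemma esg_is_derive v w y (t : R) : right_deriv S v w -> 0 < t ->
  is_derive t 1 (fun s => rip (S s v) y) (rip (S t w) y).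
Proof.
move=> vw t0; apply: is_derive1P => e e0.
pose e' := e / (2 * K * (rnorm y + 1)).
have y1 : 0 < rnorm y + 1 by rewrite ltr_wpDl ?rnorm_ge0.
have e0' : 0 < e' by rewrite !(divr_gt0, mulr_gt0).
have [d1 d10 hd1] := at_right_exists (vw _ e0').
have [d2 d20 hd2] := esg_modulus w e0'.
suff [d d0 hd] : exists2 d, 0 < d & forall h, `|h| < d -> h != 0 ->
    rnorm (S (t + h) v - S t v - h%:C *: S t w) <= 2 * K * e' * `|h|.
  exists d => // h /=; rewrite sub0r normrN => hh.
  have [->|h0] := eqVneq h 0.
    by rewrite addr0 subrr mul0r subrr normr0 mulr0.
  rewrite -ripBl -ripZl -ripBl.
  apply: le_trans (rip_CauchySchwarz ip_norm _ _) _.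
  apply: le_trans (ler_wpM2r (rnorm_ge0 _) (hd _ hh h0)) _.
  rewrite mulrAC ler_wpM2r // /e'.
  rewrite (_ : 2 * K * (e / (2 * K * (rnorm y + 1))) = e / (rnorm y + 1)); last first.
    by field; rewrite !gt_eqF.
  by rewrite -mulrA ler_piMr ?(ltW e0) // mulrC ler_pdivrMr // mul1r lerDl.
(* [t] enters so that backward steps stay at nonnegative times, where the semigroup law holds. *)
exists (Num.min d1 (Num.min d2 t)); first by rewrite !lt_min d10 d20 t0.
move=> h; rewrite !lt_min => /and3P[hd1' hd2' ht] h0.
have [h_gt0|h_le0] := ltP 0 h.
  rewrite (esg_add SK) ?(ltW t0) ?(ltW h_gt0) // -(esgZ SK) -!esgB.
  apply: le_trans (esg_bound SK _ _) _.
  apply: le_trans (ler_wpM2l (ltW K0) (hd1 _ h_gt0 _)) _.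
    by rewrite -(gtr0_norm h_gt0).
  rewrite (gtr0_norm h_gt0) mulrA ler_wpM2r ?(ltW h_gt0) // ler_pM2r //.
  by rewrite ler_peMl ?(ltW K0) // ler1n.
have {h_le0 h0}h_lt0 : h < 0 by rewrite lt_neqAle h0.
pose k := - h; have k0 : 0 < k by rewrite oppr_gt0.
rewrite (ltr0_norm h_lt0) in hd1' hd2' ht *; rewrite -/k in hd1' hd2' ht *.
have -> : h = - k by rewrite opprK.
have e1 : S t v = S (t - k) (S k v).
  by rewrite -(esg_add SK) ?subrK // ?subr_ge0 ltW.
have -> : S (t - k) v - S t v - (- k)%:C *: S t w =
    - S (t - k) (S k v - v - k%:C *: w) + k%:C *: (S t w - S (t - k) w).
  rewrite !esgB (esgZ SK) -e1 rmorphN scaleNr scalerBr.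
  rewrite !opprB !opprK.
  rewrite [RHS]addrC addrA subrK. rewrite [in RHS](addrC (_ *: _)). by [].
apply: le_trans (rnormD _ _) _; rewrite rnormN rnormZr (gtr0_norm k0).
have h1 : rnorm (S (t - k) (S k v - v - k%:C *: w)) <= K * (e' * k).
  apply: le_trans (esg_bound SK _ _) _.
  by rewrite ler_pM2l // hd1.
have h2 : rnorm (S t w - S (t - k) w) <= e'.
  by apply: hd2; rewrite opprB addrCA subrr addr0 gtr0_norm.
have h3 : e' <= K * e' by rewrite ler_peMl // ltW.
have : k * rnorm (S t w - S (t - k) w) <= k * (K * e').
  by rewrite ler_pM2l // (le_trans h2).
lra.
Qed.

End BoundedSemigroup.

(** * Weak integrals of orbits and the range of the generator *)

Section SemigroupResolvent.
Variables (R : realType) (H : completeNormedModType R[i]).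
Variable ip : {dot H for @conjc R}.
Hypothesis ip_norm : forall x : H, `|x| ^+ 2 = ip x x.
Local Notation rip := (rip ip).
Variables (S : R -> H -> H) (K : R).
Hypotheses (SK : even_semigroup S K) (K1 : 1 <= K).

Let K0 : 0 < K. Proof. exact: lt_le_trans K1. Qed.

(** The bound -1 could be any negative number: differentiability at 0 itself makes [F] continuous on
    closed intervals starting at 0. *)
Lemma esg_primitive x y : exists F : R -> R,
  forall t : R, -1 < t -> is_derive t 1 F (rip (S t x) y).
Proof.
apply: (@primitive_exists _ (fun t => rip (S t x) y)).
exact: (esg_rip_continuous ip_norm SK K1).
Qed.

Lemma esg_primitive_eq x (P : R) y (F G : R -> R) : 0 <= P ->
  (forall t : R, -1 < t -> is_derive t 1 F (rip (S t x) y)) ->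
  (forall t : R, 0 <= t -> {for t, continuous G}) ->
  (forall t : R, 0 < t -> is_derive t 1 G (rip (S t x) y)) ->
  F P - F 0 = G P - G 0.
Proof.
move=> P0 DF cG DG; apply: (@increment_eq _ _ _ (fun t => rip (S t x) y)) => //.
- by move=> t /andP[t0 _]; apply: is_derive_continuous; apply: DF; lra.
- by move=> t /andP[t0 _]; exact: cG.
- by move=> t /andP[t0 _]; apply: DF; lra.
- by move=> t /andP[t0 _]; exact: DG.
Qed.

(** The error is proportional to [rnorm y], so that bounds against every [y] assemble into a norm
    bound on the vector representing the increments. *)
Lemma esg_primitive_taylor x y (F : R -> R) (t h e : R) : 0 <= t -> 0 < h ->
  (forall t : R, -1 < t -> is_derive t 1 F (rip (S t x) y)) ->
  (forall s : R, t < s -> s < t + h -> rnorm (S s x - S t x) <= e) ->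
  `|F (t + h) - F t - h * rip (S t x) y| <= e * h * rnorm y.
Proof.
move=> t0 h0 DF hs.
have cF (s : R) : t <= s <= t + h -> {for s, continuous F}.
  by move=> /andP[ts _]; apply: is_derive_continuous; apply: DF; lra.
have DF' (s : R) : t < s < t + h -> is_derive s 1 F (rip (S s x) y).
  by move=> /andP[ts _]; apply: DF; lra.
have Dlin (c s : R) : is_derive s 1 (fun s : R => c * s) c.
  by apply: is_derive_eq; rewrite /GRing.scale /= mulr1.
have clin (c s : R) : {for s, continuous (fun s : R => c * s)}.
  exact: is_derive_continuous (Dlin c s).
have key (s : R) : t < s < t + h -> `|rip (S s x) y - rip (S t x) y| <= e * rnorm y.
  move=> /andP[ts sth]; rewrite -ripBl.
  apply: le_trans (rip_CauchySchwarz ip_norm _ _) _.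
  by apply: ler_wpM2r; [exact: rnorm_ge0|exact: hs].
have tth : t <= t + h by rewrite lerDl ltW.
have up := @increment_le _ F (fun s => (rip (S t x) y + e * rnorm y) * s) _
   (fun=> rip (S t x) y + e * rnorm y) t (t + h)
   tth cF (fun s _ => clin _ s) DF' (fun s _ => Dlin _ s).
have dn := @increment_le _ (fun s => (rip (S t x) y - e * rnorm y) * s) F
   (fun=> rip (S t x) y - e * rnorm y) _ t (t + h)
   tth (fun s _ => clin _ s) cF (fun s _ => Dlin _ s) DF'.
rewrite ler_norml; apply/andP; split.
  have : forall s : R, t < s < t + h -> rip (S t x) y - e * rnorm y <= rip (S s x) y.
    by move=> s /key; rewrite ler_norml => /andP[? ?]; lra.
  by move=> /dn; lra.
have : forall s : R, t < s < t + h -> rip (S s x) y <= rip (S t x) y + e * rnorm y.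
  by move=> s /key; rewrite ler_norml => /andP[? ?]; lra.
by move=> /up; lra.
Qed.

(* U is the weak integral of the orbit of x over [0, P]. *)
Lemma esg_integral_right_deriv x (P : R) : 0 < P ->
  exists U, right_deriv S U (S P x - x).
Proof.
move=> P0.
have /choice[F DF] := esg_primitive x.
(* The primitives [F y] are chosen separately for each [y], so only their increments depend linearly
   on [y]. *)
have phiE y (G : R -> R) :
    (forall t : R, -1 < t -> is_derive t 1 G (rip (S t x) y)) ->
    F y P - F y 0 = G P - G 0.
  move=> DG; apply: (@esg_primitive_eq x P y) => // [|t t0|t t0]; first exact: ltW.
    by apply: is_derive_continuous; apply: DG; lra.
  by apply: DG; lra.
have [||y|U hU] := @riesz_representation _ _ ip ip_norm
    (fun y => F y P - F y 0) (P * (K * rnorm x)).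
- move=> y y'; have D (t : R) : -1 < t -> is_derive t 1 (F y + F y') (rip (S t x) (y + y')).
    by move=> ht; rewrite ripDr; have ? := DF y t ht; have ? := DF y' t ht; exact: is_deriveD.
  by rewrite (phiE _ _ D) opprD addrACA.
- move=> a y; have D (t : R) : -1 < t -> is_derive t 1 (a *: F y) (rip (S t x) (a%:C *: y)).
    by move=> ht; rewrite ripZr; have ? := DF y t ht; exact: is_deriveZ.
  by rewrite (phiE _ _ D) mulrBr.
- have Dlin (c s : R) : is_derive s 1 (fun s : R => c * s) c.
    by apply: is_derive_eq; rewrite /GRing.scale /= mulr1.
  have := @increment_le _ (F y) (fun s => (K * rnorm x * rnorm y) * s)
    (fun t => rip (S t x) y) (fun=> K * rnorm x * rnorm y) 0 P (ltW P0) _ _ _ _ _.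
  rewrite mulr0 subr0 (mulrC _ P) !mulrA; apply.
  + by move=> t /andP[t0 _]; apply: is_derive_continuous; apply: DF; lra.
  + by move=> t _; apply: is_derive_continuous; exact: Dlin.
  + by move=> t /andP[t0 _]; apply: DF; lra.
  + move=> t _; apply: le_trans (rip_le ip_norm _ _) _.
    by apply: ler_wpM2r; [exact: rnorm_ge0|exact: esg_bound SK _ _].
exists U => e e0.
have e20 : 0 < e / 2 by rewrite divr_gt0.
have [d d0 hd] := esg_modulus SK K1 x e20.
exists d => //= h /=; rewrite sub0r normrN => hhd h0.
have hd' : h < d by apply: le_lt_trans hhd; exact: ler_norm.
apply: (rnorm_le_rip ip_norm); first by rewrite mulr_ge0 ?ltW.
move=> y.
have [y' hy'] := adjoint_exists ip_norm (esgD SK h) (esgZ SK h) (esg_bound SK h) y.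
(* The adjoint vector [y'] brings [S h] inside the weak integral, where it shifts the interval from
   [0, P] to [h, P + h]; only the two end pieces of length [h] survive in [S h U - U]. *)
have shiftE : rip (S h U) y = F y (P + h) - F y h.
  have cG (t : R) : 0 <= t -> {for t, continuous (fun t => F y (t + h))}.
    move=> t0; apply: (@continuous_comp _ _ _ (fun t => t + h) (F y)).
      exact: cvgD (@cvg_id _ _) (@cvg_cst _ _ _ _ _).
    by apply: is_derive_continuous; apply: DF; lra.
  have DG (t : R) : 0 < t -> is_derive t 1 (fun t => F y (t + h)) (rip (S t x) y').
    move=> t0; rewrite -hy' -(esg_add SK) ?ltW // addrC.
    have ? := DF y (t + h) ltac:(lra).
    by apply: is_derive_eq; rewrite addr0 mulr1.
  by rewrite hy' hU (esg_primitive_eq (ltW P0) (DF y') cG DG) add0r.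
have near_h s t : 0 <= t -> t < s -> s < t + h -> rnorm (S s x - S t x) <= e / 2.
  by move=> t0 ts sth; apply: hd; rewrite gtr0_norm ?subr_gt0 //; lra.
have a1 := esg_primitive_taylor (ltW P0) h0 (DF y) (fun s => near_h s P (ltW P0)).
have a2 := esg_primitive_taylor (lexx 0) h0 (DF y) (fun s => near_h s 0 (lexx 0)).
rewrite ripBl ripBl ripZl shiftE hU ripBl.
rewrite add0r (esg0 SK) in a2.
move: a1 a2; rewrite !ler_norml => /andP[_ a1] /andP[a2 _]; lra.
Qed.

(** The iterates of [v |-> x + B v] from 0 are the partial sums of the Neumann series; [B] being a
    contraction, they are Cauchy and their limit is a fixed point. *)
Lemma neumann (B : H -> H) :
  (forall x y, B (x - y) = B x - B y) ->
  (forall x, rnorm (B x) <= 2^-1 * rnorm x) ->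
  forall x, exists x', x' - B x' = x.
Proof.
move=> BB Bhalf x.
pose u n := iter n (fun v => x + B v) 0.
have uS n : u n.+1 = x + B (u n) by [].
have Bn m n : rnorm (u (n + m)%N - u n) <= 2^-1 ^+ n * rnorm (u m).
  elim: n m => [|n IH] m; first by rewrite add0n subr0 expr0 mul1r.
  rewrite addSn !uS opprD addrACA subrr add0r -BB.
  apply: le_trans (Bhalf _) _.
  by rewrite exprS -mulrA ler_pM2l ?invr_gt0.
have ub m : rnorm (u m) <= 2 * rnorm x.
  elim: m => [|m IH]; first by rewrite rnorm0 mulr_ge0 ?rnorm_ge0.
  rewrite uS; apply: le_trans (rnormD _ _) _.
  have := Bhalf (u m); lra.
have ucauchy n m k : (n <= m)%N -> (n <= k)%N ->
    rnorm (u m - u k) <= 2^-1 ^+ n * (4 * rnorm x).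
  move=> nm nk; apply: le_trans (rnorm_tri _ (u n) _) _.
  rewrite (rnormC (u n)) -(subnKC nm) -(subnKC nk).
  have p0 : 0 <= 2^-1 ^+ n :> R by rewrite exprn_ge0.
  have := Bn (m - n)%N n; have := Bn (k - n)%N n.
  have := ler_wpM2l p0 (ub (m - n)%N); have := ler_wpM2l p0 (ub (k - n)%N); lra.
have half n : 2^-1 ^+ n <= n.+1%:R^-1 :> R.
  rewrite exprVn lef_pV2 ?posrE ?exprn_gt0 // -natrX ler_nat.
  exact: ltn_expl.
have [l hl] : exists l, forall e : R, 0 < e -> \forall n \near \oo, rnorm (u n - l) < e.
  apply: rnorm_complete => e e0.
  have D0 : 0 < 4 * rnorm x + 1 by have := rnorm_ge0 x; lra.
  have [n _ /(_ n (leqnn n)) /= hn] := near_infty_natSinv_lt (PosNum (divr_gt0 e0 D0)).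
  exists n => m k nm nk; apply: le_lt_trans (ucauchy _ _ _ nm nk) _.
  have := le_lt_trans (half n) hn; rewrite ltr_pdivlMr //; apply: le_lt_trans.
  by rewrite ler_wpM2l ?exprn_ge0 // lerDl.
exists l; apply/eqP; rewrite -subr_eq0; apply/eqP/rnorm_eq0/eqP.
rewrite eq_le rnorm_ge0 andbT; apply/ler_addgt0Pr => e e0; rewrite add0r.
have e3 : 0 < e / 3 by rewrite divr_gt0.
near \oo => n.
have h1 : rnorm (u n - l) < e / 3 by near: n; exact: hl.
have h2 : rnorm (u n.+1 - l) < e / 3.
  by near: n; have [N _ hN] := hl _ e3; exists N => // k /= /leqW/hN.
have -> : l - B l - x = (u n.+1 - B l - x) - (u n.+1 - l).
  by apply: (rip_ext ip_norm) => y; rewrite !(ripDl, ripNl); ring.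
apply: le_trans (rnormB _ _) _.
have -> : u n.+1 - B l - x = B (u n - l).
  by rewrite uS BB; apply: (rip_ext ip_norm) => y; rewrite !(ripDl, ripNl); ring.
have := Bhalf (u n - l); have := rnorm_ge0 (u n - l); lra.
Unshelve. all: by end_near.
Qed.

(** If x' - S(P) x' = x, the generator sends the integral of the orbit of x' over [0, P] to S(P) x'
    - x' = - x. A finite interval thus replaces the Laplace integral over the half-line. *)
Lemma esg_range x (P : R) : 0 < P ->
  (forall x, rnorm (S P x) <= 2^-1 * rnorm x) ->
  exists v, right_deriv S v (- x).
Proof.
move=> P0 SP; have [x' hx'] := neumann (esgB SK P) SP x.
have [v hv] := esg_integral_right_deriv x' P0.
by exists v; rewrite -hx' opprB.
Qed.

End SemigroupResolvent.

(** * Complex exponentials and the semigroups e^(-z t) S(t) *)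

Section ComplexExponential.
Variable R : realType.
Implicit Types (a b t xi eta : R).

Definition cis t : R[i] := cos t +i* sin t.

Lemma cisD a b : cis (a + b) = cis a * cis b.
Proof. by rewrite /cis cosD sinD; congr (_ +i* _); rewrite addrC (mulrC (cos _)) addrC mulrC. Qed.

Lemma cis0 : cis 0 = 1.
Proof. by rewrite /cis cos0 sin0. Qed.

Lemma cisN t : cis (- t) = (cis t)^*.
Proof. by rewrite /cis cosN sinN. Qed.

(* exp (- z t) for z = xi - i eta *)
Definition cexp xi eta t : R[i] := (expR (- (xi * t)))%:C * cis (eta * t).

Lemma cexpD xi eta a b : cexp xi eta (a + b) = cexp xi eta a * cexp xi eta b.
Proof.
rewrite /cexp !mulrDr cisD opprD expRD rmorphM /=.
by rewrite -!mulrA; congr (_ * _); rewrite mulrCA.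
Qed.

Lemma cexp0 xi eta : cexp xi eta 0 = 1.
Proof. by rewrite /cexp !mulr0 oppr0 expR0 cis0 mulr1. Qed.

Lemma cexpV xi eta t : cexp (- xi) (- eta) t * cexp xi eta t = 1.
Proof.
by rewrite /cexp mulrACA -rmorphM /= -expRD -cisD !mulNr opprK subrr addNr expR0 cis0 mulr1.
Qed.

Lemma normr_cexp xi eta t : complex.Re `|cexp xi eta t| = expR (- (xi * t)).
Proof.
rewrite /cexp normrM !normc_def /= cos2Dsin2 sqrtr1 expr0n /= addr0 sqrtr_sqr.
by rewrite ger0_norm ?expR_ge0 // mulr1 mul0r subr0.
Qed.

Lemma is_deriveP1 (f : R -> R) (d t : R) : is_derive t 1 f d ->
  forall e : R, 0 < e -> \forall h \near 0, `|f (t + h) - f t - h * d| <= e * `|h|.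
Proof.
move=> [df fd] e e0.
have : h^-1 *: ((f \o shift t) (h *: (1 : R)) - f t) @[h --> 0^'] --> d.
  by rewrite -fd; exact: df.
move=> /cvgrPdist_le /(_ _ e0) [r /= r0 hr].
exists r => // h /= hh.
have [->|h0] := eqVneq h 0; first by rewrite addr0 subrr mul0r subrr normr0 mulr0.
have := hr h hh h0; rewrite /shift /= distrC.
rewrite (_ : h^-1 *: _ - d = h^-1 * (f (t + h) - f t - h * d)).
  by rewrite normrM normfV ler_pdivrMl ?normr_gt0 // (mulrC _ e).
by rewrite mulrBr mulKf // /GRing.scale /= mulr1 (addrC h).
Qed.

Lemma cexp_taylor xi eta (e : R) : 0 < e -> \forall h \near 0^'+,
  complex.Re `|cexp xi eta h - 1 - h%:C * (- xi +i* eta)| <= e * h.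
Proof.
move=> e0; have e20 : 0 < e / 2 by rewrite divr_gt0.
pose f t := expR (- (xi * t)) * cos (eta * t).
pose g t := expR (- (xi * t)) * sin (eta * t).
have Df : is_derive (0 : R) 1 f (- xi).
  apply: is_derive_eq.
  by rewrite /GRing.scale /= !mulr0 oppr0 expR0 cos0 sin0; ring.
have Dg : is_derive (0 : R) 1 g eta.
  apply: is_derive_eq.
  by rewrite /GRing.scale /= !mulr0 oppr0 expR0 cos0 sin0; ring.
near=> h.
have h0 : 0 < h by near: h; exact: nbhs_right_gt.
have hf : `|f (0 + h) - f 0 - h * (- xi)| <= e / 2 * `|h|.
  by near: h; apply: cvg_within; exact: (is_deriveP1 Df e20).
have hg : `|g (0 + h) - g 0 - h * eta| <= e / 2 * `|h|.
  by near: h; apply: cvg_within; exact: (is_deriveP1 Dg e20).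
apply: le_trans (Re_normr_le _) _.
move: hf hg; rewrite add0r (gtr0_norm h0) /f /g !mulr0 oppr0 expR0 cos0 sin0 => hf hg.
rewrite /cexp /cis /=.
apply: (le_trans (y := e / 2 * h + e / 2 * h)); last by lra.
apply: lerD.
- by apply: le_trans hf; rewrite le_eqVlt; apply/orP; left; apply/eqP; congr `|_|; ring.
- by apply: le_trans hg; rewrite le_eqVlt; apply/orP; left; apply/eqP; congr `|_|; ring.
Unshelve. all: by end_near.
Qed.

Lemma cexp_cvg1 xi eta (e : R) : 0 < e ->
  \forall h \near 0^'+, complex.Re `|cexp xi eta h - 1| <= e.
Proof.
move=> e0; set c := - xi +i* eta; pose c1 := complex.Re `|c| + 1.
have c10 : 0 < c1 by rewrite /c1 normc_def /= ltr_wpDl ?sqrtr_ge0.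
near=> h.
have h0 : 0 < h by near: h; exact: nbhs_right_gt.
have : h < e / c1 by near: h; apply: nbhs_right_lt; rewrite divr_gt0.
have : complex.Re `|cexp xi eta h - 1 - h%:C * c| <= 1 * h.
  by near: h; exact: cexp_taylor.
rewrite ltr_pdivlMr // /c1.
have := Re_normD (cexp xi eta h - 1 - h%:C * c) (h%:C * c).
rewrite subrK Re_normrM (gtr0_norm h0); lra.
Unshelve. all: by end_near.
Qed.

End ComplexExponential.

Section Rescaling.
Variables (R : realType) (H : completeNormedModType R[i]).
Variable ip : {dot H for @conjc R}.
Hypothesis ip_norm : forall x : H, `|x| ^+ 2 = ip x x.
Local Notation rip := (rip ip).

(** The absolute value keeps the family even, as [even_semigroup] requires. *)
Definition rescale (xi eta : R) (S : R -> H -> H) (t : R) (x : H) : H :=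
  cexp xi eta `|t| *: S t x.

Lemma rnorm_cexp xi eta t (x : H) :
  rnorm (cexp xi eta t *: x) = expR (- (xi * t)) * rnorm x.
Proof. by rewrite rnormZ normr_cexp. Qed.

Lemma right_deriv_eq (S S' : R -> H -> H) v w :
  (forall t, 0 < t -> S t v = S' t v) -> right_deriv S v w -> right_deriv S' v w.
Proof.
move=> SS' h e e0; near=> t.
have t0 : 0 < t by near: t; exact: nbhs_right_gt.
by rewrite -SS' //; near: t; exact: h.
Unshelve. all: by end_near.
Qed.

Lemma right_deriv_rescale xi eta (S : R -> H -> H) v w : right_deriv S v w ->
  right_deriv (rescale xi eta S) v (w + (- xi +i* eta) *: v).
Proof.
move=> Svw e e0.
set c := - xi +i* eta.
(* Room for three error terms, of sizes [2 * e' * h], [e' * h * rnorm v] and [e' * h * rnorm w]. The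
   bound [e' <= 1] gives the factor 2 for the exponential, which can exceed 1 because [xi] may be
   negative here. *)
pose D := 2 + rnorm v + rnorm w + 1.
have D0 : 0 < D by rewrite /D; have := rnorm_ge0 v; have := rnorm_ge0 w; lra.
pose e' := Num.min 1 (e / D).
have e0' : 0 < e' by rewrite lt_min ltr01 divr_gt0.
near=> h.
have h0 : 0 < h by near: h; exact: nbhs_right_gt.
have hS : rnorm (S h v - v - h%:C *: w) <= e' * h by near: h; exact: Svw.
have hc2 : complex.Re `|cexp xi eta h - 1 - h%:C * c| <= e' * h.
  by near: h; exact: cexp_taylor.
have hd : complex.Re `|cexp xi eta h - 1| <= e' by near: h; exact: cexp_cvg1.
have he : expR (- (xi * h)) <= 2.
  have := Re_normD 1 (cexp xi eta h - 1).
  rewrite addrC subrK normr_cexp normr1 [complex.Re 1]/(1 : R) => t1.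
  have e1 : e' <= 1 by rewrite ge_min lexx.
  by apply: le_trans t1 _; rewrite -[2]/(1 + 1) lerD2l; exact: le_trans hd e1.
rewrite /rescale (gtr0_norm h0).
have -> : cexp xi eta h *: S h v - v - h%:C *: (w + c *: v) =
   cexp xi eta h *: (S h v - v - h%:C *: w)
   + (cexp xi eta h - 1 - h%:C * c) *: v + h%:C *: ((cexp xi eta h - 1) *: w).
  rewrite !(mulrBr, mulr1, scalerBr, scalerBl, scalerDr, scalerA, scale1r).
  rewrite (mulrC h%:C (cexp _ _ _)).
  by apply: (rip_ext ip_norm) => y; rewrite !(ripDl, ripNl); ring.
apply: le_trans (rnormD _ _) _.
apply: (le_trans (y := 2 * (e' * h) + e' * h * rnorm v + h * (e' * rnorm w))).
  apply: lerD; [apply: le_trans (rnormD _ _) _; apply: lerD|].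
  - by rewrite rnorm_cexp; apply: ler_pM => //; rewrite ?expR_ge0 ?rnorm_ge0.
  - by rewrite rnormZ ler_wpM2r ?rnorm_ge0.
  - by rewrite rnormZr (gtr0_norm h0) ler_pM2l // rnormZ ler_wpM2r ?rnorm_ge0.
have : e' * D <= e by rewrite -ler_pdivlMr // ge_min lexx orbT.
move=> /(ler_wpM2r (ltW h0)); rewrite /D; have : 0 <= e' * h by rewrite mulr_ge0 ?ltW.
lra.
Unshelve. all: by end_near.
Qed.

(** The forward implication comes from rescaling back with [- xi] and [- eta]. *)
Lemma right_deriv_rescaleE xi eta (S : R -> H -> H) v w :
  right_deriv (rescale xi eta S) v w <->
  right_deriv S v (w + (xi -i* eta) *: v).
Proof.
split=> [/(right_deriv_rescale (- xi) (- eta))|/(right_deriv_rescale xi eta)].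
  rewrite opprK; apply: right_deriv_eq => t t0.
  by rewrite /rescale scalerA cexpV scale1r.
rewrite -addrA -scalerDl (_ : (xi -i* eta) + (- xi +i* eta) = 0) ?scale0r ?addr0 //.
by apply/eqP; rewrite eq_complex /= subrr addNr !eqxx.
Qed.

Lemma rescale_even_semigroup xi eta (S : R -> H -> H) K : 0 <= xi ->
  (forall t (z : R[i]) x, S t (z *: x) = z *: S t x) ->
  even_semigroup S K -> even_semigroup (rescale xi eta S) K.
Proof.
move=> xi0 SZ SK; split.
- by move=> t x y; rewrite /rescale (esgD SK) scalerDr.
- by move=> t a x; rewrite /rescale SZ !scalerA mulrC.
- by move=> x; rewrite /rescale normr0 cexp0 scale1r (esg0 SK).
- move=> s t x s0 t0; rewrite /rescale SZ scalerA -cexpD (esg_add SK) //.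
  by rewrite !ger0_norm ?addr_ge0.
- move=> t x; rewrite /rescale rnorm_cexp; apply: le_trans (esg_bound SK t x).
  by rewrite ler_piMl ?rnorm_ge0 // -expR0 ler_expR oppr_le0 mulr_ge0.
- by move=> t x; rewrite /rescale normr_id (esg_abs SK).
- move=> x e e0.
  pose e' := e / (rnorm x + 2).
  have x2 : 0 < rnorm x + 2 by have := rnorm_ge0 x; lra.
  have e0' : 0 < e' by rewrite divr_gt0.
  near=> h.
  have h0 : 0 < h by near: h; exact: nbhs_right_gt.
  have hS : rnorm (S h x - x) <= e' by near: h; exact: (esg_cvg0 SK).
  have hd : complex.Re `|cexp xi eta h - 1| <= e' by near: h; exact: cexp_cvg1.
  rewrite /rescale (gtr0_norm h0).
  have -> : cexp xi eta h *: S h x - x =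
    cexp xi eta h *: (S h x - x) + (cexp xi eta h - 1) *: x.
    by rewrite scalerBr scalerBl scale1r addrA subrK.
  apply: le_trans (rnormD _ _) _; rewrite rnorm_cexp rnormZ.
  have h2 : expR (- (xi * h)) <= 1 by rewrite -expR0 ler_expR oppr_le0 mulr_ge0 // ltW.
  have h3 : expR (- (xi * h)) * rnorm (S h x - x) <= 1 * e'.
    by apply: ler_pM => //; rewrite ?expR_ge0 ?rnorm_ge0.
  have h4 : complex.Re `|cexp xi eta h - 1| * rnorm x <= e' * rnorm x.
    by rewrite ler_wpM2r ?rnorm_ge0.
  have h5 : e' * (rnorm x + 2) = e by rewrite /e' divfK // gt_eqF.
  lra.
Unshelve. all: by end_near.
Qed.

End Rescaling.

Section RightDerivative.
Variables (R : realType) (H : completeNormedModType R[i]).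
Variable ip : {dot H for @conjc R}.
Hypothesis ip_norm : forall x : H, `|x| ^+ 2 = ip x x.
Local Notation rip := (rip ip).
Variables (S : R -> H -> H) (K : R).
Hypotheses (SK : even_semigroup S K) (K1 : 1 <= K).

Lemma right_derivD v v' w w' : right_deriv S v w -> right_deriv S v' w' ->
  right_deriv S (v + v') (w + w').
Proof.
move=> h h' e e0; have e20 : 0 < e / 2 by rewrite divr_gt0.
near=> t.
have h1 : rnorm (S t v - v - t%:C *: w) <= e / 2 * t by near: t; exact: h.
have h2 : rnorm (S t v' - v' - t%:C *: w') <= e / 2 * t by near: t; exact: h'.
have -> : S t (v + v') - (v + v') - t%:C *: (w + w') =
  (S t v - v - t%:C *: w) + (S t v' - v' - t%:C *: w').
  rewrite (esgD SK) scalerDr.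
  by apply: (rip_ext ip_norm) => y; rewrite !(ripDl, ripNl); ring.
by apply: le_trans (rnormD _ _) _; lra.
Unshelve. all: by end_near.
Qed.

Lemma right_derivZ (c : R[i]) v w :
  (forall t x, S t (c *: x) = c *: S t x) ->
  right_deriv S v w -> right_deriv S (c *: v) (c *: w).
Proof.
move=> SZ h e e0; pose d := complex.Re `|c| + 1.
have c0 : 0 <= complex.Re `|c| by rewrite normc_def /= sqrtr_ge0.
have d0 : 0 < d by rewrite /d; lra.
near=> t.
have t0 : 0 < t by near: t; exact: nbhs_right_gt.
have h1 : rnorm (S t v - v - t%:C *: w) <= e / d * t.
  by near: t; apply: h; rewrite divr_gt0.
have -> : S t (c *: v) - c *: v - t%:C *: (c *: w) = c *: (S t v - v - t%:C *: w).
  by rewrite SZ !scalerBr !scalerA (mulrC c).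
rewrite rnormZ; apply: le_trans (ler_wpM2l c0 h1) _.
have : e / d * d = e by rewrite divfK // gt_eqF.
have : 0 < e / d by rewrite divr_gt0.
rewrite /d; nra.
Unshelve. all: by end_near.
Qed.

(** As the generator sends [v] to [- x], the vector [v - S P v] is the integral of the orbit of [x]
    over [0, P]; this is its weak form, with the integrand replaced by a majorant [dg] whose
    primitive is known. *)
Lemma right_deriv_increment v x y (P : R) (g dg : R -> R) : 0 <= P ->
  right_deriv S v (- x) ->
  (forall t : R, is_derive t 1 g (dg t)) ->
  (forall t, 0 < t -> rip (S t x) y <= dg t) ->
  rip (v - S P v) y <= g P - g 0.
Proof.
move=> P0 vx Dg hg.
have := @increment_le _ (fun t => - rip (S t v) y) g (fun t => rip (S t x) y) dg 0 P P0.
rewrite (esg0 SK) opprK addrC -ripBl; apply.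
- move=> t _; apply: continuousN.
  exact: (esg_rip_continuous ip_norm SK K1).
- by move=> t _; apply: is_derive_continuous; exact: Dg.
- move=> t /andP[t0 _]; rewrite -[rip (S t x) y]opprK.
  have := @esg_is_derive _ _ _ ip_norm _ _ SK K1 v (- x) y t vx t0.
  rewrite (esgN SK) ripNl => ?.
  exact: is_deriveN.
- by move=> t /andP[t0 _]; exact: hg.
Qed.

End RightDerivative.

(** * Resolvents in the open right half-plane *)

Section Resolvent.
Variables (R : realType) (H : completeNormedModType R[i]).
Variable ip : {dot H for @conjc R}.
Hypothesis ip_norm : forall x : H, `|x| ^+ 2 = ip x x.
Local Notation rip := (rip ip).
Variables (T : R -> {linear H -> H}) (A : unbounded_op H).
Hypotheses (T_C0 : C0_semigroup T) (T_gen : generator T (opp_op A)).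
Variable K : R.
Hypotheses (K1 : 1 <= K)
  (TK : forall t x, 0 <= t -> rnorm (T t x) <= K * rnorm x).

Let K0 : 0 < K. Proof. exact: lt_le_trans K1. Qed.

Definition evenext (t : R) (x : H) : H := T `|t| x.

Lemma evenextZ t (z : R[i]) x : evenext t (z *: x) = z *: evenext t x.
Proof. by rewrite /evenext linearZ. Qed.

Lemma evenext_semigroup : even_semigroup evenext K.
Proof.
have [_ T0 TD Tc] := T_C0.
split.
- by move=> t x y; rewrite /evenext linearD.
- by move=> t a x; rewrite evenextZ.
- by move=> x; rewrite /evenext normr0 T0.
- by move=> s t x s0 t0; rewrite /evenext !ger0_norm ?addr_ge0 // TD.
- by move=> t x; exact: TK.
- by move=> t x; rewrite /evenext normr_id.
- move=> x e e0; near=> h.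
  have h0 : 0 < h by near: h; exact: nbhs_right_gt.
  rewrite /evenext gtr0_norm // ltW //; near: h.
  by have /cvg_rnormP := Tc x; exact.
Unshelve. all: by end_near.
Qed.

Lemma generator_right_deriv v w :
  (op_dom A v /\ A v = w) <-> right_deriv evenext v (- w).
Proof.
have -> : (op_dom A v /\ A v = w) <-> (op_dom (opp_op A) v /\ (opp_op A) v = - w).
  split=> -[dv e]; split=> //=; first by rewrite -e.
  by apply: oppr_inj; exact: e.
rewrite (T_gen v (- w)) cvg_rnormP.
have E h : 0 < h -> rnorm (evenext h v - v - h%:C *: (- w)) =
    h * rnorm ((h^-1)%:C *: (T h v - v) - - w).
  move=> h0; rewrite -[X in X * _]gtr0_norm // -rnormZr; congr rnorm.
  rewrite scalerBr scalerA -rmorphM /= mulfV ?gt_eqF // scale1r.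
  by rewrite /evenext gtr0_norm.
split=> h e e0.
  near=> t; have t0 : 0 < t by near: t; exact: nbhs_right_gt.
  rewrite E // mulrC ler_pM2r // ltW //; near: t; exact: h.
have e20 : 0 < e / 2 by rewrite divr_gt0.
near=> t; have t0 : 0 < t by near: t; exact: nbhs_right_gt.
have : rnorm (evenext t v - v - t%:C *: (- w)) <= e / 2 * t by near: t; exact: h.
by rewrite E // mulrC ler_pM2r // => h1; apply: le_lt_trans h1 _; lra.
Unshelve. all: by end_near.
Qed.

Definition damped (xi eta : R) := rescale xi eta evenext.

Lemma damped_semigroup xi eta : 0 <= xi -> even_semigroup (damped xi eta) K.
Proof.
move=> xi0; apply: (rescale_even_semigroup _ xi0) evenext_semigroup.
exact: evenextZ.
Qed.

Lemma dampedZ xi eta t (z : R[i]) x : damped xi eta t (z *: x) = z *: damped xi eta t x.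
Proof. by rewrite /damped /rescale evenextZ !scalerA mulrC. Qed.

Lemma rnorm_damped xi eta t x : 0 <= t ->
  rnorm (damped xi eta t x) <= K * expR (- (xi * t)) * rnorm x.
Proof.
move=> t0; rewrite rnorm_cexp ger0_norm // (mulrC K) -mulrA.
by rewrite ler_wpM2l ?expR_ge0 // /evenext ger0_norm // TK.
Qed.

Lemma damped_half (xi : R) : 0 < xi -> exists2 P : R, 0 < P & K * expR (- (xi * P)) <= 2^-1.
Proof.
move=> xi0; have K2 : 1 < 2 * K by have := K1; lra.
exists (ln (2 * K) / xi); first by rewrite divr_gt0 // ln_gt0.
rewrite (mulrC xi) divfK ?gt_eqF // expRN lnK ?posrE; last by lra.
by rewrite invfM mulrCA mulfV ?mulr1 // gt_eqF.
Qed.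

Lemma damped_half_le (xi eta P : R) x : 0 < P -> K * expR (- (xi * P)) <= 2^-1 ->
  rnorm (damped xi eta P x) <= 2^-1 * rnorm x.
Proof.
move=> P0 hP; apply: le_trans (rnorm_damped _ _ _ (ltW P0)) _.
by rewrite ler_wpM2r ?rnorm_ge0.
Qed.

(** The generator of the damped semigroup is -(z + A) with z = [xi -i* eta]; this reduces existence,
    uniqueness and bounds for the resolvent to statements about [right_deriv]. *)
Lemma resolvent_eqP (xi eta : R) v x :
  op_dom (add_scalar_op (xi -i* eta) A) v /\ add_scalar_op (xi -i* eta) A v = x <->
  right_deriv (damped xi eta) v (- x).
Proof.
rewrite (right_deriv_rescaleE ip_norm).
rewrite -[- x + _]opprK -generator_right_deriv /=.
rewrite opprD opprK; split=> -[dv e]; split=> //.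
  by rewrite -e addrC addKr.
by rewrite e addrC subrK.
Qed.

(** The integral of [K * expR (- (xi * t))] is at most [K / xi]; the factor 2 recovers [v] from v -
    S(P) v. *)
Lemma damped_deriv_bound (xi eta : R) v x : 0 < xi ->
  right_deriv (damped xi eta) v (- x) -> rnorm v <= 2 * K / xi * rnorm x.
Proof.
move=> xi0 vx; have [P P0 hP] := damped_half xi0.
have hS := damped_half_le eta v P0 hP.
suff : rnorm (v - damped xi eta P v) <= K / xi * rnorm x.
  have := rnorm_tri v (damped xi eta P v) 0; rewrite !subr0.
  rewrite -!mulrA; lra.
apply: (rnorm_le_rip ip_norm); first by rewrite mulr_ge0 ?rnorm_ge0 // divr_ge0 ?ltW.
move=> y; set c := K / xi * rnorm x * rnorm y.
have c0 : 0 <= c by rewrite !mulr_ge0 ?rnorm_ge0 // ?invr_ge0 ?ltW.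
pose g (t : R) := - (c * expR (- (xi * t))).
have := @right_deriv_increment _ _ _ ip_norm _ _ (damped_semigroup eta (ltW xi0)) K1
  v x y P g (fun t => c * xi * expR (- (xi * t))) (ltW P0) vx.
move=> /(_ _ _)/le_trans; apply.
- move=> t; apply: is_derive_eq; rewrite /GRing.scale /=; ring.
- move=> t t0; apply: le_trans (rip_le ip_norm _ _) _.
  apply: le_trans (ler_wpM2r (rnorm_ge0 _) (rnorm_damped _ _ _ (ltW t0))) _.
  rewrite /c [X in _ <= X](_ : _ = K * expR (- (xi * t)) * rnorm x * rnorm y) //.
  by field; rewrite gt_eqF.
rewrite /g mulr0 oppr0 expR0 mulr1.
by rewrite opprK gerDr oppr_le0 mulr_ge0 // expR_ge0.
Qed.

Lemma damped_deriv_uniq (xi eta : R) v v' x : 0 < xi ->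
  right_deriv (damped xi eta) v (- x) -> right_deriv (damped xi eta) v' (- x) -> v = v'.
Proof.
move=> xi0 h h'; apply/eqP; rewrite -subr_eq0; apply/eqP/rnorm_eq0.
have SK := damped_semigroup eta (ltW xi0).
have h2 : right_deriv (damped xi eta) (- v') x.
  have := right_derivZ (fun t x => dampedZ xi eta t (-1) x) h'.
  by rewrite !scaleN1r opprK.
have := right_derivD ip_norm SK h h2; rewrite addNr -oppr0.
move=> /(damped_deriv_bound xi0); rewrite rnorm0 mulr0 => h3.
by apply/eqP; rewrite eq_le h3 rnorm_ge0.
Qed.

Lemma resolvent_deriv (xi eta : R) x : 0 < xi ->
  right_deriv (damped xi eta) (res (xi -i* eta) A x) (- x).
Proof.
move=> xi0; have [P P0 hP] := damped_half xi0.
have [v hv] := esg_range ip_norm (damped_semigroup eta (ltW xi0)) K1 x P0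
  (fun x => damped_half_le eta x P0 hP).
by apply/resolvent_eqP; rewrite /res /inv_op; case: xgetP => [u _ //|/(_ v)[]]; exact/resolvent_eqP.
Qed.

Lemma resolvent_uniq (xi eta : R) v x : 0 < xi ->
  right_deriv (damped xi eta) v (- x) -> v = res (xi -i* eta) A x.
Proof. by move=> xi0 h; exact: (damped_deriv_uniq xi0 h (resolvent_deriv eta x xi0)). Qed.

Lemma resolventD (xi eta : R) x y : 0 < xi ->
  res (xi -i* eta) A (x + y) = res (xi -i* eta) A x + res (xi -i* eta) A y.
Proof.
move=> xi0; apply/esym/resolvent_uniq => //; rewrite opprD.
by apply: (right_derivD ip_norm (damped_semigroup eta (ltW xi0))); exact: resolvent_deriv.
Qed.

Lemma resolventZ (xi eta : R) (c : R[i]) x : 0 < xi ->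
  res (xi -i* eta) A (c *: x) = c *: res (xi -i* eta) A x.
Proof.
move=> xi0; apply/esym/resolvent_uniq => //; rewrite -scalerN.
by apply: right_derivZ; [move=> *; exact: dampedZ|exact: resolvent_deriv].
Qed.

Lemma resolventB (xi eta : R) x y : 0 < xi ->
  res (xi -i* eta) A (x - y) = res (xi -i* eta) A x - res (xi -i* eta) A y.
Proof. by move=> xi0; rewrite resolventD // -[- y]scaleN1r resolventZ // scaleN1r. Qed.

Lemma resolvent_bound (xi eta : R) x : 0 < xi ->
  rnorm (res (xi -i* eta) A x) <= 2 * K / xi * rnorm x.
Proof. by move=> xi0; exact: damped_deriv_bound (resolvent_deriv _ _ xi0). Qed.

Lemma resolvent_lipschitz (xi eta eta' : R) x : 0 < xi ->
  rnorm (res (xi -i* eta) A x - res (xi -i* eta') A x)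
  <= (2 * K / xi) ^+ 2 * rnorm x * `|eta - eta'|.
Proof.
move=> xi0; set v := res (xi -i* eta') A x.
(* The resolvent identity: [v] solves the equation at [eta] with right side x + (z - z') v, where z
   - z' = -i (eta - eta'). *)
have hv : right_deriv (damped xi eta) v (- (x + (0 -i* (eta - eta')) *: v)).
  have /(right_deriv_rescaleE ip_norm) := resolvent_deriv eta' x xi0; rewrite -/v => h.
  apply/(right_deriv_rescaleE ip_norm); rewrite opprD -addrA -scaleNr -scalerDl.
  rewrite (_ : - (0 -i* (eta - eta')) + (xi -i* eta) = xi -i* eta') //.
  by apply/eqP; rewrite eq_complex /=; apply/andP; split; apply/eqP; ring.
rewrite {1}(resolvent_uniq xi0 hv) resolventD // resolventZ //.
rewrite opprD addrA subrr add0r rnormN rnormZ.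
rewrite normc_def /= expr0n /= add0r sqrtr_sqr normrN mulrC ler_wpM2r //.
apply: le_trans (resolvent_bound _ _ xi0) _.
rewrite expr2 -[_ * _ * rnorm x]mulrA ler_wpM2l ?resolvent_bound //.
by rewrite divr_ge0 ?mulr_ge0 ?(ltW K0) ?(ltW xi0).
Qed.

End Resolvent.

(** * Orthogonality of characters and discrete square functions *)

Section TrigonometricOrthogonality.
Variables (R : realType) (H : completeNormedModType R[i]).
Variable ip : {dot H for @conjc R}.
Hypothesis ip_norm : forall x : H, `|x| ^+ 2 = ip x x.
Local Notation rip := (rip ip).

Lemma cis_natmul (a : R) n : cis a = 1 -> cis (n%:R * a) = 1.
Proof.
move=> a1; elim: n => [|n IH]; first by rewrite mul0r cis0.
by rewrite -natr1 mulrDl mul1r cisD IH a1 mulr1.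
Qed.

Lemma cis_2pi : cis (2 * pi) = 1 :> R[i].
Proof.
rewrite /cis mulrC mulr_natr -[pi *+ 2]add0r cosD2pi sinD2pi.
by rewrite cos0 sin0.
Qed.

Lemma rip_cis a b (x y : H) : rip (cis a *: x) (cis b *: y) =
  cos (a - b) * rip x y + sin (a - b) * rip ('i%C *: x) y.
Proof.
rewrite ripC rip_conj -cisN scalerA -cisD ripC (addrC (- b)).
have -> : cis (a - b) = (cos (a - b))%:C + (sin (a - b))%:C * 'i%C.
  by rewrite [RHS]complexE /=; apply/eqP; rewrite eq_complex /=; apply/andP; split; apply/eqP; ring.
by rewrite scalerDl -scalerA ripDl !ripZl.
Qed.

(** [Q] is written out term by term. The diagonal terms are linear in [t]; the off-diagonal ones are
    trigonometric of frequency (j - k) h, nonzero as [h != 0], and agree at 0 and at [P] because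
    [cis (h * P) = 1]. The common frequency [s] cancels. *)
Lemma trig_parseval (m : nat) (c : 'I_m -> H) (s h P : R) :
  h != 0 -> cis (h * P) = 1 ->
  exists2 Q : R -> R,
    forall t : R, is_derive t 1 Q (rnorm (\sum_(k < m) cis ((s + k%:R * h) * t) *: c k) ^+ 2) &
    Q P - Q 0 = P * \sum_(k < m) rnorm (c k) ^+ 2.
Proof.
move=> h0 hP.
pose tau (j k : 'I_m) : R := (j%:R - k%:R) * h.
have tau0 j k : j != k -> tau j k != 0.
  move=> jk; rewrite mulf_neq0 // subr_eq0 eqr_nat.
  by apply: contra jk => /eqP/val_inj ->.
pose q (j k : 'I_m) (t : R) : R := if j == k then t * rip (c j) (c k) else
  (tau j k)^-1 * (sin (tau j k * t) * rip (c j) (c k)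
                 - cos (tau j k * t) * rip ('i%C *: c j) (c k)).
have Dq j k (t : R) : is_derive t 1 (q j k)
    (cos (tau j k * t) * rip (c j) (c k) + sin (tau j k * t) * rip ('i%C *: c j) (c k)).
  rewrite /q; case: eqVneq => [->|/tau0 jk].
    rewrite /tau subrr !mul0r cos0 sin0 mul0r addr0 mul1r.
    by apply: is_derive_eq; rewrite /GRing.scale /=; ring.
  apply: is_derive_eq; rewrite /GRing.scale /=.
  by field.
pose Q : R -> R := \sum_(j < m) \sum_(k < m) q j k.
exists Q.
  move=> t; apply: is_derive_eq.
  rewrite -(rip_norm ip_norm) rip_suml; apply: eq_bigr => j _.
  rewrite rip_sumr; apply: eq_bigr => k _.
  by rewrite rip_cis -mulrBl opprD addrACA subrr add0r -mulrBl.
rewrite /Q !fct_sumE -sumrB mulr_sumr; apply: eq_bigr => j _.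
rewrite !fct_sumE -sumrB (bigD1 j) //= big1 ?addr0 => [|k kj].
  by rewrite /q eqxx mul0r subr0 (rip_norm ip_norm).
have hj (i : 'I_m) : cis (i%:R * (h * P)) = 1 by exact: cis_natmul.
have : cis (tau j k * P) = 1.
  by rewrite /tau -mulrA mulrBl cisD cisN !hj conjc1 mulr1.
rewrite /cis => -[ec es].
by rewrite /q eq_sym (negPf kj) ec es !mulr0 cos0 sin0 subrr.
Qed.

Lemma unimodular_phase (z : R[i]) : exists2 th : R[i],
  complex.Re `|th| = 1 & complex.Re (th * z) = complex.Re `|z|.
Proof.
have [->|z0] := eqVneq z 0; first by exists 1; rewrite ?normr1 // mulr0 normr0.
pose r := complex.Re `|z|.
have rE : `|z| = r%:C by rewrite /r RRe_real // ger0_real.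
have r0 : 0 < r by rewrite -ltcR -rE normr_gt0.
exists ((r^-1)%:C * z^*).
  by rewrite Re_normrM normcJ -/r ger0_norm ?invr_ge0 ?ltW // mulVf // gt_eqF.
rewrite -/r -mulrA (mulrC z^*) -sqr_normc rE -rmorphXn -rmorphM /=.
by rewrite expr2 mulKf // gt_eqF.
Qed.

End TrigonometricOrthogonality.

Section SquareFunction.
Variables (R : realType) (H : completeNormedModType R[i]).
Variable ip : {dot H for @conjc R}.
Hypothesis ip_norm : forall x : H, `|x| ^+ 2 = ip x x.
Local Notation rip := (rip ip).
Variables (T : R -> {linear H -> H}) (A : unbounded_op H).
Hypotheses (T_C0 : C0_semigroup T) (T_gen : generator T (opp_op A)).
Variable K : R.
Hypotheses (K1 : 1 <= K)
  (TK : forall t x, 0 <= t -> rnorm (T t x) <= K * rnorm x).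
Variables (xi P h : R).
Hypotheses (xi0 : 0 < xi) (P0 : 0 < P) (hP : K * expR (- (xi * P)) <= 2^-1)
  (h0 : h != 0) (hperiod : cis (h * P) = 1).

Let K0 : 0 < K. Proof. exact: lt_le_trans K1. Qed.

(** Only the sum over [k] of the integrands has to be dominated, which preserves the cancellation
    between frequencies that orthogonality exploits. *)
Lemma damped_sum_increment m (v x y : 'I_m -> H) (eta : 'I_m -> R) (g dg : R -> R) :
  (forall k, right_deriv (damped T xi (eta k)) (v k) (- x k)) ->
  (forall t : R, -1 < t -> is_derive t 1 g (dg t)) ->
  (forall t, 0 < t -> \sum_(k < m) rip (damped T xi (eta k) t (x k)) (y k) <= dg t) ->
  \sum_(k < m) rip (v k - damped T xi (eta k) P (v k)) (y k) <= g P - g 0.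
Proof.
move=> vx Dg hg.
have SK k := damped_semigroup T_C0 TK (eta k) (ltW xi0).
pose f k (t : R) := - rip (damped T xi (eta k) t (v k)) (y k).
have := @increment_le _ (\sum_(k < m) f k) g
  (fun t => \sum_(k < m) rip (damped T xi (eta k) t (x k)) (y k)) dg 0 P (ltW P0).
have -> : (\sum_(k < m) f k) P - (\sum_(k < m) f k) 0 =
   \sum_(k < m) rip (v k - damped T xi (eta k) P (v k)) (y k).
  rewrite !fct_sumE -sumrB; apply: eq_bigr => k _.
  by rewrite /f (esg0 (SK k)) opprK addrC -ripBl.
have Df k (t : R) : 0 < t -> is_derive t 1 (f k) (rip (damped T xi (eta k) t (x k)) (y k)).
  move=> t0; rewrite -[rip (damped _ _ _ t (x k)) _]opprK.
  have := @esg_is_derive _ _ _ ip_norm _ _ (SK k) K1 (v k) (- x k) (y k) t (vx k) t0.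
  rewrite (esgN (SK k)) ripNl => ?.
  exact: is_deriveN.
apply.
- move=> t _.
  suff : continuous (\sum_(k < m) f k) by exact.
  elim/big_ind : _ => [|F G cF cG|k _].
  + by move=> s; exact: cvg_cst.
  + by move=> s; apply: cvgD; [exact: cF|exact: cG].
  + by move=> s; apply: cvgN; exact: (esg_rip_continuous ip_norm (SK k) K1).
- by move=> t /andP[t0 _]; apply: is_derive_continuous; apply: Dg; lra.
- by move=> t /andP[t0 _]; apply: is_derive_sum => k; exact: Df.
- by move=> t /andP[t0 _]; apply: Dg; lra.
- by move=> t /andP[t0 _]; exact: hg.
Qed.

Lemma rnorm_sub_damped eta (v : H) :
  rnorm v <= 2 * rnorm (v - damped T xi eta P v).
Proof.
have := damped_half_le TK eta v P0 hP.
have := rnorm_tri v (damped T xi eta P v) 0; rewrite !subr0; lra.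
Qed.

Lemma young (a p r : R) : 0 < a -> p * r <= 2^-1 * (a * p ^+ 2 + r ^+ 2 / a).
Proof.
move=> a0; have : 0 <= a^-1 * (a * p - r) ^+ 2 by rewrite mulr_ge0 ?invr_ge0 ?sqr_ge0 ?ltW.
have -> : a^-1 * (a * p - r) ^+ 2 = a * p ^+ 2 + r ^+ 2 / a - 2 * (p * r).
  by field; rewrite gt_eqF.
lra.
Qed.

(* With c_k = (1 - e^(-z_k P) T(P)) R_k u, the sum of the |c_k|^2 is the integral
   over [0, P] of e^(-xi t) <T(t) u, sum_k e^(-i eta_k t) c_k>. *)
Lemma resolvent_square_sum m (sigma : R) (u : H) (g dg : R -> R) :
  (forall t : R, -1 < t -> is_derive t 1 g (dg t)) ->
  (forall t, 0 < t -> (expR (- (xi * t)) * rnorm (T t u)) ^+ 2 <= dg t) ->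
  \sum_(k < m) rnorm (res (xi -i* (sigma + k%:R * h)) A u) ^+ 2 <= 4 * P * (g P - g 0).
Proof.
move=> Dg hg.
pose eta (k : 'I_m) := sigma + k%:R * h.
pose v k := res (xi -i* eta k) A u.
pose c k := v k - damped T xi (eta k) P (v k).
have hv k : right_deriv (damped T xi (eta k)) (v k) (- u).
  exact: (resolvent_deriv ip_norm T_C0 T_gen K1 TK).
(* The characters are moved to the second argument of the inner product, hence conjugated: the
   frequencies change sign. *)
have [||Q DQ QP] := @trig_parseval _ _ _ ip_norm m c (- sigma) (- h) P.
- by rewrite oppr_eq0.
- by rewrite mulNr cisN hperiod conjc1.
pose E t := \sum_(k < m) cis ((- sigma + k%:R * - h) * t) *: c k.
(* Young's inequality with weight [P]: by Parseval the term in [E] integrates to the sum on the left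
   with coefficient one half, and can be absorbed. *)
have main : \sum_(k < m) rnorm (c k) ^+ 2 <=
   2^-1 * (P * (g P - g 0) + \sum_(k < m) rnorm (c k) ^+ 2).
  have -> : \sum_(k < m) rnorm (c k) ^+ 2 =
      \sum_(k < m) rip (v k - damped T xi (eta k) P (v k)) (c k).
    by apply: eq_bigr => k _; rewrite -(rip_norm ip_norm).
  have -> : 2^-1 * (P * (g P - g 0) + \sum_(k < m) rip (v k - damped T xi (eta k) P (v k)) (c k)) =
      (2^-1 * (P * g P + Q P / P)) - (2^-1 * (P * g 0 + Q 0 / P)).
    rewrite [X in _ + X](_ : _ = (Q P - Q 0) / P); first by ring.
    rewrite QP (mulrC P) mulfK ?gt_eqF //.
    by apply: eq_bigr => k _; rewrite -(rip_norm ip_norm).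
  apply: (@damped_sum_increment m v (fun=> u) c eta
    (fun t => 2^-1 * (P * g t + Q t / P))
    (fun t => 2^-1 * (P * dg t + rnorm (E t) ^+ 2 / P))) => //.
    move=> t t1; have ? := Dg t t1; have ? := DQ t.
    by apply: is_derive_eq; rewrite /GRing.scale /= -/(E t); ring.
  move=> t t0.
  have -> : \sum_(k < m) rip (damped T xi (eta k) t u) (c k) =
    rip ((expR (- (xi * t)))%:C *: T t u) (E t).
    rewrite /E rip_sumr; apply: eq_bigr => k _.
    rewrite /damped /rescale /evenext gtr0_norm // /cexp mulrC -scalerA rip_conj.
    by rewrite -cisN /eta mulrN -opprD mulNr.
  apply: le_trans (rip_le ip_norm _ _) _; rewrite rnormZr gtr0_norm ?expR_gt0 //.
  apply: le_trans (young _ _ P0) _.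
  by rewrite ler_pM2l ?invr_gt0 // lerD2r ler_pM2l // hg.
have : \sum_(k < m) rnorm (v k) ^+ 2 <= 4 * \sum_(k < m) rnorm (c k) ^+ 2.
  rewrite mulr_sumr; apply: ler_sum => k _.
  have := rnorm_sub_damped (eta k) (v k); rewrite -/(c k).
  have := rnorm_ge0 (v k); have := rnorm_ge0 (c k); nra.
by rewrite -/(v _) /v; lra.
Qed.

(* e^(-z_k P) T(P) does not depend on k, so r = sum_k R_k c_k is bounded by
   2 |r - e^(-z_k P) T(P) r|, an integral over [0, P]. *)
Lemma resolvent_sum m (sigma a : R) (c : 'I_m -> H) : 0 < a ->
  rnorm (\sum_(k < m) res (xi -i* (sigma + k%:R * h)) A (c k)) <=
  K * (a / (2 * xi) + P * (\sum_(k < m) rnorm (c k) ^+ 2) / a).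
Proof.
move=> a0.
pose eta (k : 'I_m) := sigma + k%:R * h.
pose v k := res (xi -i* eta k) A (c k).
have hv k : right_deriv (damped T xi (eta k)) (v k) (- c k).
  exact: (resolvent_deriv ip_norm T_C0 T_gen K1 TK).
have [Q DQ QP] := @trig_parseval _ _ _ ip_norm m c sigma h P h0 hperiod.
pose E t := \sum_(k < m) cis ((sigma + k%:R * h) * t) *: c k.
set r := \sum_(k < m) _; pose D := \sum_(k < m) rnorm (c k) ^+ 2.
have D0 : 0 <= D by apply: sumr_ge0 => k _; exact: sqr_ge0.
have -> : r = \sum_(k < m) v k by [].
have dampedE : damped T xi sigma P r = \sum_(k < m) damped T xi (eta k) P (v k).
  rewrite /r /damped /rescale /evenext raddf_sum scaler_sumr.
  apply: eq_bigr => k _; rewrite /eta gtr0_norm // /cexp mulrDl.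
  by rewrite cisD -mulrA cis_natmul // mulr1.
apply: le_trans (rnorm_sub_damped sigma r) _.
rewrite dampedE /r -sumrB -[leRHS](mulVKf (x := 2)) // ler_pM2l //.
apply: (rnorm_le_rip ip_norm) => [|w].
  have xi2 : 0 <= 2 * xi by rewrite mulr_ge0 // ltW.
  rewrite mulr_ge0 ?invr_ge0 // mulr_ge0 ?(ltW K0) // addr_ge0 //.
    by rewrite divr_ge0 // ltW.
  by rewrite divr_ge0 ?mulr_ge0 // ltW.
rewrite rip_suml.
(* Young's inequality with the free weight [a], after bounding [T t] by [K]: in [g] the exponential
   contributes at most [a / (2 * xi)] and, by Parseval, the other part [P * D / a]. *)
pose b := 2^-1 * K * rnorm w.
pose g t := b * (- (a / (2 * xi)) * expR (- (2 * xi * t)) + Q t / a).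
have := @damped_sum_increment m v c (fun=> w) eta g
  (fun t => b * (a * expR (- (2 * xi * t)) + rnorm (E t) ^+ 2 / a)) hv.
have b0 : 0 <= b by rewrite !mulr_ge0 ?rnorm_ge0 ?invr_ge0 ?ltW.
move=> /(_ _ _)/le_trans; apply.
- move=> t _; have ? := DQ t.
  apply: is_derive_eq; rewrite /GRing.scale /= -/(E t).
  by field; rewrite !gt_eqF.
- move=> t t0.
  have -> : \sum_(k < m) rip (damped T xi (eta k) t (c k)) w =
    rip ((expR (- (xi * t)))%:C *: T t (E t)) w.
    rewrite /E -rip_suml; congr (rip _ w).
    rewrite raddf_sum scaler_sumr; apply: eq_bigr => k _.
    rewrite /damped /rescale /evenext gtr0_norm // /cexp.
    have TZ (z : R[i]) x : T t (z *: x) = z *: T t x by rewrite linearZ.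
    by rewrite -scalerA -TZ.
  apply: le_trans (rip_le ip_norm _ _) _; rewrite rnormZr gtr0_norm ?expR_gt0 //.
  have e2 : expR (- (2 * xi * t)) = expR (- (xi * t)) ^+ 2.
    by rewrite expr2 -expRD; congr expR; ring.
  have h1 := @young a (expR (- (xi * t))) (rnorm (E t)) a0.
  have h2 := TK (E t) (ltW t0).
  rewrite e2 /b.
  have h3 : expR (- (xi * t)) * rnorm (T t (E t)) <= expR (- (xi * t)) * (K * rnorm (E t)).
    by rewrite ler_pM2l ?expR_gt0.
  have h4 : expR (- (xi * t)) * (K * rnorm (E t)) <=
      K * (2^-1 * (a * expR (- (xi * t)) ^+ 2 + rnorm (E t) ^+ 2 / a)).
    by rewrite mulrCA ler_pM2l.
  have := ler_wpM2r (rnorm_ge0 w) (le_trans h3 h4).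
  by move=> /le_trans; apply; rewrite le_eqVlt; apply/orP; left; apply/eqP; ring.
rewrite /g mulr0 oppr0 expR0 mulr1 -mulrBr.
rewrite [X in _ <= X](_ : _ = b * (a / (2 * xi) + P * D / a)); last by rewrite /b /D; ring.
rewrite ler_wpM2l //.
have -> : P * D / a = Q P / a - Q 0 / a by rewrite -QP mulrBl.
have : 0 <= a / (2 * xi) * expR (- (2 * xi * P)).
  by rewrite mulr_ge0 ?expR_ge0 // divr_ge0 ?mulr_ge0 // ltW.
lra.
Qed.

(** Unimodular phases [th k] turn the sum of moduli into one inner product, with the sum of the R_k
    (th_k R_k u), so [resolvent_sum] applies with the square sum as input. Its weight is taken as
    [P * s], which gives both terms the same factor [P]. *)
Lemma resolvent_sqr_sum m (sigma s : R) (u y : H) (g dg : R -> R) : 0 < s ->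
  (forall t : R, -1 < t -> is_derive t 1 g (dg t)) ->
  (forall t, 0 < t -> (expR (- (xi * t)) * rnorm (T t u)) ^+ 2 <= dg t) ->
  \sum_(k < m) complex.Re `|ip (res (xi -i* (sigma + k%:R * h)) A
     (res (xi -i* (sigma + k%:R * h)) A u)) y|
  <= P * (K * (s / (2 * xi) + 4 * (g P - g 0) / s)) * rnorm y.
Proof.
move=> s0 Dg hg.
pose v (k : 'I_m) := res (xi -i* (sigma + k%:R * h)) A u.
have [th th1 thE] : exists2 th : 'I_m -> R[i], forall k, complex.Re `|th k| = 1 &
    forall k, complex.Re (th k * ip (res (xi -i* (sigma + k%:R * h)) A (v k)) y) =
       complex.Re `|ip (res (xi -i* (sigma + k%:R * h)) A (v k)) y|.
  have /choice[th hth] : forall k : 'I_m, exists th, complex.Re `|th| = 1 /\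
     complex.Re (th * ip (res (xi -i* (sigma + k%:R * h)) A (v k)) y) =
       complex.Re `|ip (res (xi -i* (sigma + k%:R * h)) A (v k)) y|.
    move=> k; have [t ? ?] := unimodular_phase (ip (res (xi -i* (sigma + k%:R * h)) A (v k)) y).
    by exists t.
  by exists th => k; have [] := hth k.
rewrite [X in X <= _](_ : _ = rip (\sum_(k < m) res (xi -i* (sigma + k%:R * h)) A (th k *: v k)) y).
  apply: le_trans (rip_le ip_norm _ _) _; apply: ler_wpM2r; first exact: rnorm_ge0.
  apply: le_trans (@resolvent_sum m sigma (P * s) (fun k => th k *: v k) _) _.
    by rewrite mulr_gt0.
  have -> : \sum_(k < m) rnorm (th k *: v k) ^+ 2 = \sum_(k < m) rnorm (v k) ^+ 2.
    by apply: eq_bigr => k _; rewrite rnormZ th1 mul1r.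
  have := resolvent_square_sum m sigma Dg hg; rewrite -/(v _).
  set D := \sum_(k < m) _ => hD.
  rewrite mulrCA ler_pM2l // mulrDr lerD //; first by rewrite !mulrA.
  rewrite invfM mulrA (mulrAC P) mulfV ?gt_eqF // mul1r.
  by rewrite mulrA ler_pM2r ?invr_gt0 //; move: hD; rewrite mulrA (mulrC P).
rewrite rip_suml; apply: eq_bigr => k _; rewrite -thE.
by rewrite (resolventZ ip_norm T_C0 T_gen K1 TK) // /rip linearZl_LR.
Qed.

End SquareFunction.

(** * Integrals of possibly nonmeasurable functions *)

Section NonmeasurableBounds.
Local Open Scope ereal_scope.
Context d (X : measurableType d) (R : realType).
Variable mu : {measure set X -> \bar R}.
Import HBNNSimple.
Implicit Types (D : set X) (f g : X -> \bar R).

(* xi |-> sup_eta |f'(xi + i eta)| is not known to be measurable, which the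
   library's comparison and scaling lemmas would require. *)
Lemma ge0_integral_mono D f g :
  (forall x, D x -> 0 <= f x) -> (forall x, D x -> f x <= g x) ->
  \int[mu]_(x in D) f x <= \int[mu]_(x in D) g x.
Proof.
move=> f0 fg; have g0 x : D x -> 0 <= g x by move=> Dx; exact: (le_trans (f0 _ Dx) (fg _ Dx)).
rewrite !ge0_integralE //; apply: ereal_sup_le => _ [h /= hf <-]; exists h => //= x.
apply: le_trans (hf x) _; rewrite /patch; case: ifPn => // /set_mem; exact: fg.
Qed.

(** For [k] positive, a simple function below [k f] divided by [k] is one below [f]. *)
Lemma ge0_integral_scale_le D (k : R) f : (0 <= k)%R -> (forall x, D x -> 0 <= f x) ->
  \int[mu]_(x in D) (k%:E * f x) <= k%:E * \int[mu]_(x in D) f x.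
Proof.
move=> k_ge0 f0; have [->|kN0] := eqVneq k 0%R.
  by rewrite mul0e integral0_eq // => x _; rewrite mul0e.
have k0 : (0 < k)%R by rewrite lt_neqAle eq_sym kN0.
rewrite !ge0_integralE //; last first.
  by move=> x Dx; rewrite mule_ge0 ?f0 // lee_fin ltW.
apply: ge_ereal_sup => _ [h /= hf <-].
have ki : (0 <= k^-1)%R by rewrite invr_ge0 ltW.
rewrite -lee_pdivrMl // -sintegralrM.
apply: ereal_sup_ubound; exists (scale_nnsfun h ki) => //= x.
rewrite EFinM lee_pdivrMl //; apply: le_trans (hf x) _.
by rewrite /patch; case: ifPn => // _; rewrite mule0.
Qed.

(** The positive and negative parts of [g] each integrate to something between 0 and the integral of
    [f]; when one of them is infinite, so is the bound. *)
Lemma abs_Rintegral_le D (g : X -> R) f :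
  (forall x, D x -> `|g x|%:E <= f x) ->
  (`|\int[mu]_(x in D) g x|%R)%:E <= \int[mu]_(x in D) f x.
Proof.
move=> gf; rewrite /Rintegral integralE.
set a := \int[mu]_(x in D) _; set b := \int[mu]_(x in D) _; set I := \int[mu]_(x in D) _.
have a0 : 0 <= a by apply: integral_ge0 => x _; exact: funepos_ge0.
have b0 : 0 <= b by apply: integral_ge0 => x _; exact: funeneg_ge0.
have aI : a <= I.
  apply: ge0_integral_mono => x Dx; first exact: funepos_ge0.
  by apply: le_trans (gf _ Dx); rewrite funeposE ge_max !lee_fin ler_norm normr_ge0.
have bI : b <= I.
  apply: ge0_integral_mono => x Dx; first exact: funeneg_ge0.
  by apply: le_trans (gf _ Dx); rewrite funenegE ge_max -EFinN !lee_fin normr_ge0 -normrN ler_norm.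
have I0 : 0 <= I := le_trans a0 aI.
move: a b a0 b0 aI bI => [a||] [b||] //= a0 b0 aI bI; rewrite ?normr0 //.
move: aI bI; clear I0; case: I => [I aI bI|_ _|/(le_trans a0) //]; last exact: leey.
rewrite !lee_fin in a0 b0 aI bI *; rewrite ler_norml; apply/andP; split; lra.
Qed.

Lemma ge0_integral_exhaust (F : (set X)^nat) f (B : \bar R) :
  nondecreasing_seq F -> (forall i, measurable (F i)) ->
  (forall i, measurable_fun (F i) f) -> (forall i x, F i x -> 0 <= f x) ->
  (forall i, \int[mu]_(x in F i) f x <= B) ->
  \int[mu]_(x in \bigcup_i F i) f x <= B.
Proof.
move=> nF mF mf f0 FB.
have := ge0_nondecreasing_set_cvg_integral nF mF mf f0.
by move=> /(_ mu) h; apply: (@cvge_le _ _ _ _ _ _ _ _ h); exact: nearW.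
Qed.

End NonmeasurableBounds.

(** * Continuous integrands: exhaustion by segments *)

Section ContinuousIntegrals.
Variable R : realType.
Implicit Types (F G c : R -> R).
Local Notation mu := (@lebesgue_measure R).

Lemma integral_segment_primitive F c (a b : R) : a < b ->
  (forall s, a <= s <= b -> {for s, continuous c}) ->
  (forall s, a <= s <= b -> is_derive s 1 F (c s)) ->
  (\int[mu]_(s in `[a, b]) (c s)%:E = (F b - F a)%:E)%E.
Proof.
move=> ab cc DF; rewrite EFinB; apply: continuous_FTC2 => //.
- apply: continuous_in_subspaceT => s /set_mem /=; rewrite in_itv /=; exact: cc.
- have cF s : a <= s <= b -> {for s, continuous F}.
    by move=> /DF /is_derive_continuous.
  split.
  + move=> s; rewrite in_itv /= => /andP[sa sb].
    by have [] : is_derive s 1 F (c s) by apply: DF; rewrite !ltW.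
  + by apply: cvg_at_right_filter; apply: cF; rewrite lexx ltW.
  + by apply: cvg_at_left_filter; apply: cF; rewrite lexx ltW.
- move=> s; rewrite in_itv /= => /andP[sa sb].
  have ? : is_derive s 1 F (c s) by apply: DF; rewrite !ltW.
  by rewrite derive1E derive_val.
Qed.

Lemma continuous_on_measurable c (a b : R) :
  (forall s, a <= s <= b -> {for s, continuous c}) ->
  measurable_fun `[a, b] (EFin \o c).
Proof.
move=> cc; apply/measurable_EFinP.
apply: subspace_continuous_measurable_fun => //.
by apply: continuous_in_subspaceT => s /set_mem /=; rewrite in_itv /=; exact: cc.
Qed.

Lemma integral_pos_line_le F c (B : R) :
  (forall s : R, 0 < s -> {for s, continuous c}) ->
  (forall s : R, 0 < s -> 0 <= c s) ->
  (forall s : R, 0 < s -> is_derive s 1 F (c s)) ->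
  (forall a b : R, 0 < a -> a < b -> F b - F a <= B) ->
  (\int[mu]_(s in `]0%R, +oo[) (c s)%:E <= B%:E)%E.
Proof.
move=> cc c0 DF FB.
(* With [n.+2] the segments are nondegenerate even for [n = 0], where [n.+1] would give a single
   point. *)
pose D (n : nat) := [set` `[n.+2%:R^-1 : R, n.+2%:R]].
have Dpos n s : D n s -> 0 < s.
  by rewrite /D /= in_itv /= => /andP[h _]; apply: lt_le_trans h; rewrite invr_gt0.
have -> : [set` `]0%R, +oo[] = \bigcup_n D n.
  apply/seteqP; split => s; last by move=> [n _ /Dpos s0] /=; rewrite in_itv /= s0.
  rewrite /= in_itv /= andbT => s0.
  have sV0 : 0 < s^-1 by rewrite invr_gt0.
  have [n hn] : exists n : nat, Num.max s s^-1 <= n%:R.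
    by exists (Num.truncn (Num.max s s^-1)).+1; apply: ltW; exact: truncnS_gt.
  exists n => //; rewrite /D /= in_itv /=; apply/andP; split.
    rewrite -[s]invrK lef_pV2 ?posrE //; apply: (@le_trans _ _ n%:R).
      by apply: le_trans hn; rewrite le_max lexx orbT.
    by rewrite ler_nat -addn2 leq_addr.
  apply: (@le_trans _ _ n%:R); first by apply: le_trans hn; rewrite le_max lexx.
  by rewrite ler_nat -addn2 leq_addr.
have ab (n : nat) : n.+2%:R^-1 < n.+2%:R :> R.
  by rewrite (@lt_trans _ _ 1) ?ltr1n // invf_lt1 ?ltr1n.
apply: ge0_integral_exhaust.
- apply/nondecreasing_seqP => n; apply/subsetPset => s; rewrite /D /= !in_itv /=.
  move=> /andP[h1 h2]; apply/andP; split.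
    by apply: le_trans h1; rewrite lef_pV2 ?posrE ?ler_nat.
  by apply: le_trans h2 _; rewrite ler_nat.
- by move=> n; exact: measurable_itv.
- move=> n; apply: continuous_on_measurable => s /andP[h _].
  by apply: cc; apply: lt_le_trans h; rewrite invr_gt0.
- by move=> n s /Dpos /c0; rewrite lee_fin.
- move=> n; have cc' (s : R) : n.+2%:R^-1 <= s <= n.+2%:R -> 0 < s.
    by move=> /andP[h _]; apply: lt_le_trans h; rewrite invr_gt0.
  have -> : (\int[mu]_(s in D n) (c s)%:E = (F n.+2%:R - F n.+2%:R^-1)%:E)%E.
    apply: integral_segment_primitive (ab n) _ _ => s /cc'; [exact: cc|exact: DF].
  by rewrite lee_fin FB // invr_gt0.
Qed.

(* The integral over the line is the integral over one period of the sums of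
   the translates. *)
Lemma integral_line_le_translates c (h B : R) : 0 < h ->
  continuous c -> (forall s, 0 <= c s) ->
  (forall m s, \sum_(k < m) c (s + k%:R * h) <= B) ->
  (\int[mu]_(s in setT) (c s)%:E <= (h * B)%:E)%E.
Proof.
move=> h0 cc c0 cB.
pose D (n : nat) := [set` `[- (n.+1%:R * h), n.+1%:R * h]].
have -> : [set: R] = \bigcup_n D n.
  apply/seteqP; split => // s _.
  exists (Num.truncn (`|s| / h)) => //; rewrite /D /= in_itv /= -ler_norml.
  by rewrite -ler_pdivrMr //; apply: ltW; exact: truncnS_gt.
apply: ge0_integral_exhaust.
- apply/nondecreasing_seqP => n; apply/subsetPset => s; rewrite /D /= !in_itv /= -!ler_norml.
  by move=> /le_trans; apply; rewrite ler_pM2r // ler_nat.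
- by move=> n; exact: measurable_itv.
- by move=> n; apply: continuous_on_measurable => s _; exact: cc.
- by move=> n s _; rewrite lee_fin.
move=> n; set a := n.+1%:R * h.
have a0 : 0 < a by rewrite mulr_gt0.
have [F DF] := primitive_exists (- a - 1) cc.
have -> : (\int[mu]_(s in D n) (c s)%:E = (F a - F (- a))%:E)%E.
  apply: integral_segment_primitive => [|s _|s /andP[hs _]].
  - by rewrite gtrN.
  - exact: cc.
  - by apply: DF; apply: lt_le_trans hs; rewrite -/a ltrBlDr ltrDl.
rewrite lee_fin.
(* The segment from [- a] to [a] consists of [m] intervals of length [h], half of them on each side
   of 0; the increments of [F] over them telescope. *)
pose m := (n.+1).*2.
pose f (k : nat) (s : R) := F (s + (- a + k%:R * h)).
have Df (k : nat) (s : R) : 0 <= s -> is_derive s 1 (f k) (c (- a + s + k%:R * h)).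
  move=> s0; have k0 : 0 <= k%:R * h by rewrite mulr_ge0 // ltW.
  have e : - a + s + k%:R * h = s + (- a + k%:R * h) by ring.
  have ? := DF (s + (- a + k%:R * h)) ltac:(lra).
  by rewrite e; apply: is_derive_eq; rewrite addr0 mulr1.
have Dsum (s : R) : 0 <= s ->
    is_derive s 1 (\sum_(k < m) f k) (\sum_(k < m) c (- a + s + k%:R * h)).
  by move=> s0; apply: (@is_derive_sum _ _ _ m (fun k : 'I_m => f k)) => k; exact: Df.
have Dlin (s : R) : is_derive s 1 (fun s : R => B * s) B.
  by apply: is_derive_eq; rewrite /GRing.scale /= mulr1.
have := @increment_le _ (\sum_(k < m) f k) (fun s => B * s)
  (fun s => \sum_(k < m) c (- a + s + k%:R * h)) (fun=> B) 0 h (ltW h0).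
have sumE s : (\sum_(k < m) f k) s = \sum_(k < m) f k s by rewrite fct_sumE.
rewrite !sumE -sumrB mulr0 subr0 (mulrC B).
have -> : \sum_(k < m) (f k h - f k 0) = F a - F (- a).
  pose w k := F (- a + k%:R * h).
  have -> : \sum_(k < m) (f k h - f k 0) = \sum_(0 <= k < m) (w k.+1 - w k).
    rewrite big_mkord; apply: eq_bigr => k _; rewrite /f /w add0r -natr1.
    by congr (F _ - _); ring.
  rewrite telescope_sumr // /w mul0r addr0; congr (F _ - _).
  by rewrite /m -mul2n natrM -mulrA -/a; ring.
apply.
- by move=> s /andP[s0 _]; exact: is_derive_continuous (Dsum s s0).
- by move=> s _; exact: is_derive_continuous (Dlin s).
- by move=> s /andP[s0 _]; apply: Dsum; exact: ltW.
- by move=> s _; exact: cB.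
Qed.

End ContinuousIntegrals.

(** * Operator norms, and decay of orbits starting in the domain of A *)

Section OperatorNorm.
Variables (R : realType) (H : completeNormedModType R[i]).

Lemma opnorm_ubound (B : H -> H) (x : H) : rnorm x <= 1 ->
  ((rnorm (B x))%:E <= opnorm B)%E.
Proof.
move=> x1; apply: ereal_sup_ubound; exists x => //=.
by rewrite normr_rnorm -[1]/(1%:C) lecR.
Qed.

Lemma opnorm_le (B : H -> H) (c : \bar R) :
  (forall x, rnorm x <= 1 -> ((rnorm (B x))%:E <= c)%E) -> (opnorm B <= c)%E.
Proof.
move=> Bc; apply: ge_ereal_sup => _ [x /= x1 <-]; apply: Bc.
by move: x1; rewrite normr_rnorm -[1]/(1%:C) lecR.
Qed.

Lemma opnorm_bound (B : H -> H) (c : R) :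
  (forall (a : R) x, B (a%:C *: x) = a%:C *: B x) ->
  (opnorm B <= c%:E)%E -> forall x, rnorm (B x) <= c * rnorm x.
Proof.
move=> BZ Bc x; have [x0|xN0] := eqVneq (rnorm x) 0.
  rewrite x0 (rnorm_eq0 x0) -(scale0r (0 : H)) -[0 : R[i]]/(0%:C) BZ scale0r.
  by rewrite rnorm0 mulr0.
have x0 : 0 < rnorm x by rewrite lt_neqAle eq_sym xN0 rnorm_ge0.
have : rnorm (B (((rnorm x)^-1)%:C *: x)) <= c.
  rewrite -lee_fin; apply: le_trans Bc; apply: opnorm_ubound.
  by rewrite rnormZr gtr0_norm ?invr_gt0 // mulVf.
by rewrite BZ rnormZr gtr0_norm ?invr_gt0 // mulrC ler_pdivrMr.
Qed.

End OperatorNorm.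

Section Decay.
Variables (R : realType) (H : completeNormedModType R[i]).
Variable ip : {dot H for @conjc R}.
Hypothesis ip_norm : forall x : H, `|x| ^+ 2 = ip x x.
Local Notation rip := (rip ip).
Variables (beta : R) (T : R -> {linear H -> H}) (A : unbounded_op H).
Hypotheses (beta0 : 0 < beta)
  (T_C0 : C0_semigroup T) (T_gen : generator T (opp_op A))
  (T_stable : polynomially_stable beta T A).

Lemma semigroup_bound : exists2 K : R, 1 <= K &
  forall t x, 0 <= t -> rnorm (T t x) <= K * rnorm x.
Proof.
have [supT _] := T_stable; move: supT; set s := ereal_sup _ => soo.
have s0 : (0 <= s)%E.
  apply: (@le_trans _ _ (opnorm (T 0))).
    apply: le_trans (@opnorm_ubound _ _ (T 0) 0 _); last by rewrite rnorm0.
    by rewrite lee_fin rnorm_ge0.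
  by apply: ereal_sup_ubound; exists 0 => //=.
exists (Num.max 1 (fine s)); first by rewrite le_max lexx.
move=> t x t0; apply: opnorm_bound => [a y|]; first by rewrite linearZ.
apply: (@le_trans _ _ s); first by apply: ereal_sup_ubound; exists t.
rewrite -[leLHS]fineK ?ge0_fin_numE //.
by rewrite lee_fin le_max lexx orbT.
Qed.

Variable K : R.
Hypotheses (K1 : 1 <= K)
  (TK : forall t x, 0 <= t -> rnorm (T t x) <= K * rnorm x).

Let K0 : 0 < K. Proof. exact: lt_le_trans K1. Qed.
Let SK := evenext_semigroup T_C0 TK.

(** Shifting time by one keeps the rate finite at 0, so that an asymptotic bound becomes one valid
    for all nonnegative times. *)
Definition rate (t : R) : R := (1 + t) `^ (- beta^-1).

Lemma rate_gt0 t : 0 <= t -> 0 < rate t.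
Proof. by move=> t0; rewrite powR_gt0 // ltr_pwDl. Qed.

Lemma real_axisE (s : R) : s%:C = s -i* 0.
Proof. by apply/eqP; rewrite eq_complex /= oppr0 !eqxx. Qed.

Lemma orbit_resolvent_decay : exists2 C : R, 0 < C &
  forall t x, 0 <= t -> rnorm (T t (res 1 A x)) <= C * rate t * rnorm x.
Proof.
have [_ [K' hK']] := T_stable.
have one : (1 : R[i]) = 1 -i* 0 by rewrite -real_axisE.
have bi : 0 <= beta^-1 by rewrite invr_ge0 ltW.
have [t0 t01 ht0] : exists2 t0 : R, 1 <= t0 & forall t, t0 < t ->
    (opnorm (T t \o res 1%R A) <= (K' * t `^ (- beta^-1))%R%:E)%E.
  have [M [_ hM]] := hK'.
  exists (Num.max 1 M); first by rewrite le_max lexx.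
  by move=> t; rewrite gt_max => /andP[_ /hM].
have resZ (a : R) x : res 1 A (a%:C *: x) = a%:C *: res 1 A x.
  by rewrite one (resolventZ ip_norm T_C0 T_gen K1 TK).
have resB x : rnorm (res 1 A x) <= 2 * K * rnorm x.
  rewrite one; apply: le_trans (resolvent_bound ip_norm T_C0 T_gen K1 TK _ _ ltr01) _.
  by rewrite divr1.
(* First term: beyond [t0 >= 1], the inequality 1 + t <= 2 t turns t^(-1/beta) into [rate t]. Second
   term: up to [t0] the orbit is bounded by [K * (2 * K)] and [rate t] is at least (1 +
   t0)^(-1/beta). *)
pose C := `|K'| * 2 `^ beta^-1 + K * (2 * K) * (1 + t0) `^ beta^-1.
have C0 : 0 < C.
  by rewrite /C ltr_wpDl ?mulr_ge0 ?powR_ge0 // !mulr_gt0 // powR_gt0 //; lra.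
exists C => // t x tge0.
have r0 := rate_gt0 tge0.
have x0 := rnorm_ge0 x.
have pow_rate a : 0 < a -> 1 + t <= a -> 1 <= a `^ beta^-1 * rate t.
  move=> a0 ta; rewrite /rate powRN.
  rewrite -ler_pdivrMr ?invr_gt0 ?powR_gt0 ?ltr_pwDl // invrK mul1r.
  by rewrite ge0_ler_powR ?nnegrE //; lra.
have [tt0|t0t] := leP t t0.
  apply: le_trans (TK _ tge0) _.
  apply: le_trans (ler_wpM2l (ltW K0) (resB x)) _.
  rewrite mulrA ler_wpM2r //.
  apply: (@le_trans _ _ (K * (2 * K) * (1 + t0) `^ beta^-1 * rate t)).
    rewrite -[leRHS]mulrA ler_peMr ?mulr_ge0 ?(ltW K0) // pow_rate //; lra.
  by rewrite ler_wpM2r ?(ltW r0) // lerDr mulr_ge0 // powR_ge0.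
have h := opnorm_bound _ (ht0 _ t0t).
apply: le_trans (h _ x) _; first by move=> a y /=; rewrite resZ linearZ.
rewrite ler_wpM2r //.
apply: (@le_trans _ _ (`|K'| * 2 `^ beta^-1 * rate t)).
  apply: (@le_trans _ _ (`|K'| * t `^ (- beta^-1))).
    by rewrite ler_wpM2r ?powR_ge0 // ler_norm.
  rewrite -mulrA ler_wpM2l //.
  have tgt0 : 0 < t by lra.
  have : 1 <= (2 * t) `^ beta^-1 * rate t by apply: pow_rate; lra.
  rewrite powRM ?(ltW tgt0) // powRN -mulrA mulrCA => h1.
  by rewrite -[leLHS]mulr1 ler_pdivrMl ?powR_gt0.
rewrite ler_wpM2r ?(ltW r0) // lerDl mulr_ge0 ?powR_ge0 //.
by rewrite !mulr_ge0 ?(ltW K0).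
Qed.

Lemma rate_cvg0 (e : R) : 0 < e -> exists2 t, 0 < t & rate t <= e.
Proof.
move=> e0; exists ((e `^ (- beta)) + 1); first by rewrite ltr_wpDl ?powR_ge0.
rewrite /rate (powRN _ beta^-1); have bi : 0 < beta^-1 by rewrite invr_gt0.
have h : e `^ (- beta) <= 1 + (e `^ (- beta) + 1) by lra.
have h1 : e^-1 <= (1 + (e `^ (- beta) + 1)) `^ beta^-1.
  apply: le_trans (ge0_ler_powR (ltW bi) _ _ h); rewrite ?nnegrE ?powR_ge0 //.
    by rewrite -powRrM mulNr mulfV ?gt_eqF // powR_inv1 // ltW.
  by apply: le_trans h; exact: powR_ge0.
by rewrite -[leRHS]invrK lef_pV2 ?posrE ?invr_gt0 // powR_gt0 //; have := powR_ge0 e (- beta); lra.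
Qed.

(* If A v = w then v - T(t) v is an integral of T(s) w over [0, t], while T(t) v
   tends to 0 with v + w; this bounds v, hence T(t) v, in terms of w only. *)
Lemma orbit_range_decay : exists2 C : R, 0 < C &
  forall t v w, 0 <= t -> right_deriv (evenext T) v (- w) ->
    rnorm (T t v) <= C * rate t * rnorm w /\ rnorm v <= C * rnorm w.
Proof.
have [C C0 hC] := orbit_resolvent_decay.
have hvw t v w : 0 <= t -> right_deriv (evenext T) v (- w) ->
    rnorm (T t v) <= C * rate t * (rnorm v + rnorm w).
  move=> t0 vw.
  have e : v = res 1%R A (v + w).
    rewrite (_ : (1 : R[i]) = 1 -i* 0); last by rewrite -real_axisE.
    apply: (resolvent_uniq ip_norm T_C0 T_gen K1 TK ltr01).
    apply/(right_deriv_rescaleE ip_norm).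
    rewrite (_ : - (v + w) + (1 -i* 0) *: v = - w) //.
    by rewrite -real_axisE scale1r opprD addrAC addNr add0r.
  rewrite {1}e; apply: le_trans (hC _ _ t0) _; rewrite ler_wpM2l ?rnormD //.
  by rewrite mulr_ge0 ?ltW // rate_gt0.
(* At this [t0] the decay factor is at most one half, so the term in [rnorm v] is absorbed into the
   left side; this leaves the constant [1 + 2 * K * t0]. *)
have [t0 t00 ht0] : exists2 t, 0 < t & rate t <= (2 * C)^-1.
  by apply: rate_cvg0; rewrite invr_gt0 mulr_gt0.
have hv v w : right_deriv (evenext T) v (- w) -> rnorm v <= (1 + 2 * K * t0) * rnorm w.
  move=> vw.
  have h1 : rnorm (v - evenext T t0 v) <= K * t0 * rnorm w.
    apply: (rnorm_le_rip ip_norm); first by rewrite !mulr_ge0 ?rnorm_ge0 ?(ltW K0) ?(ltW t00).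
    move=> y; have := @right_deriv_increment _ _ _ ip_norm _ _ SK K1 v w y t0
      (fun t => (K * rnorm w * rnorm y) * t) (fun=> K * rnorm w * rnorm y) (ltW t00) vw.
    move=> /(_ _ _)/le_trans; apply.
    - by move=> t; apply: is_derive_eq; rewrite /GRing.scale /= mulr1.
    - move=> t _; apply: le_trans (rip_le ip_norm _ _) _.
      by rewrite ler_wpM2r ?rnorm_ge0 // TK.
    by rewrite mulr0 subr0 le_eqVlt; apply/orP; left; apply/eqP; ring.
  have h2 : rnorm (T t0 v) <= 2^-1 * (rnorm v + rnorm w).
    apply: le_trans (hvw _ _ _ (ltW t00) vw) _.
    rewrite ler_wpM2r ?addr_ge0 ?rnorm_ge0 //.
    apply: le_trans (ler_wpM2l (ltW C0) ht0) _; rewrite le_eqVlt; apply/orP; left.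
    by apply/eqP; field; rewrite gt_eqF.
  have := rnorm_tri v (evenext T t0 v) 0; rewrite !subr0.
  move: h1 h2; rewrite /evenext gtr0_norm //; lra.
pose D := 1 + 2 * K * t0.
have D0 : 0 < D by rewrite /D addr_gt0 // !mulr_gt0.
exists (C * (D + 1) + D); first by rewrite addr_gt0 // mulr_gt0 // addr_gt0.
move=> t v w tt0 vw; have w0 := rnorm_ge0 w; have r0 := rate_gt0 tt0.
have h1 := hv _ _ vw; have h2 := hvw _ _ _ tt0 vw.
split.
  apply: le_trans h2 _; rewrite -!mulrA.
  have h3 : rate t * (rnorm v + rnorm w) <= rate t * ((D + 1) * rnorm w).
    by rewrite ler_pM2l //; rewrite -/D in h1; lra.
  apply: le_trans (ler_wpM2l (ltW C0) h3) _.
  rewrite mulrCA [leRHS]mulrCA ler_pM2l // mulrA ler_wpM2r //.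
  by rewrite lerDl ltW.
apply: le_trans h1 _; rewrite -/D ler_wpM2r //.
by rewrite lerDr ltW // mulr_gt0 // addr_gt0.
Qed.

End Decay.

(** * Explicit primitives for powers *)

Section PowerCalculus.
Variable R : realType.
Implicit Types (a s t q xi : R).

Lemma continuous_powR a s : 0 < s -> {for s, continuous (@powR R ^~ a)}.
Proof. by move=> s0; apply: is_derive_continuous; exact: is_derive1_powR. Qed.

(** For positive [a], a bounded primitive of the function a s^(a - 1) (1 + s)^(- a - 1). It captures
    an integrable singularity at 0 and takes the place of an incomplete Gamma integral. *)
Definition ratio_pow a s := (s / (1 + s)) `^ a.

Lemma is_derive_ratio_pow a s : 0 < s ->
  is_derive s 1 (ratio_pow a) (a * (s / (1 + s)) `^ (a - 1) * ((1 + s) ^+ 2)^-1).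
Proof.
move=> s0; have s1 : 0 < 1 + s by rewrite addr_gt0.
have s1N : 1 + s != 0 by rewrite gt_eqF.
have D1 : is_derive s 1 (fun s => (1 + s)^-1) (- ((1 + s) ^+ 2)^-1).
  have D0 : is_derive s 1 (fun s => 1 + s) 1.
    apply: is_derive_eq; rewrite /GRing.scale /=. by ring.
  apply: (is_derive_eq (is_deriveV s1N D0)); rewrite /GRing.scale /=. by rewrite mulr1.
have D2 : is_derive s 1 (fun s => s / (1 + s)) ((1 + s) ^+ 2)^-1.
  apply: is_derive_eq; rewrite /GRing.scale /=.
  by field.
have D3 : is_derive (s / (1 + s)) 1 (@powR R ^~ a) (a * (s / (1 + s)) `^ (a - 1)).
  by apply: is_derive1_powR; rewrite divr_gt0.
exact: (@is_derive1_comp _ (@powR R ^~ a) (fun s => s / (1 + s)) s _ _ D3 D2).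
Qed.

Lemma ratio_pow_ge0 a s : 0 <= ratio_pow a s.
Proof. exact: powR_ge0. Qed.

Lemma ratio_pow_le1 a s : 0 <= a -> 0 < s -> ratio_pow a s <= 1.
Proof.
move=> a0 s0; rewrite [leRHS](_ : 1 = 1 `^ a); last by rewrite powR1.
apply: ge0_ler_powR; rewrite ?nnegrE //.
  by rewrite divr_ge0 ?addr_ge0 ?ltW.
by rewrite ler_pdivrMr ?addr_gt0 // mul1r lerDr.
Qed.

Lemma powR_antitone a s t : a <= 0 -> 0 < s -> s <= t -> t `^ a <= s `^ a.
Proof.
move=> a0 s0 st; rewrite -[a]opprK !(powRN _ (- a)).
rewrite lef_pV2 ?posrE ?powR_gt0 ?(lt_le_trans s0) //.
by apply: ge0_ler_powR; rewrite ?nnegrE ?oppr_ge0 ?(ltW s0) // (le_trans (ltW s0)).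
Qed.

Lemma ratio_ge a s : a <= 0 -> 0 < s -> s `^ a <= (s / (1 + s)) `^ a.
Proof.
move=> a0 s0; apply: powR_antitone => //; first by rewrite divr_gt0 ?addr_gt0.
by rewrite ler_pdivrMr ?addr_gt0 // ler_peMr ?ltW // ltrDl.
Qed.

(** Substitute w = xi (1 + t) and take a = 1 - 2 q, so that (1 + t)^(-2 q) is a multiple of w^(a -
    1). The factor e^(-2 xi t) is dominated by 4 (1 + w)^(-2), since 1 + w <= 2 + xi t <= 2 e^(xi t)
    when xi <= 1. *)
Lemma damped_power_primitive q xi : q < 1 / 2 -> 0 < q -> 0 < xi -> xi <= 1 ->
  exists g dg : R -> R, [/\ forall t, -1 < t -> is_derive t 1 g (dg t),
    forall t, 0 < t -> (expR (- (xi * t)) * (1 + t) `^ (- q)) ^+ 2 <= dg t &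
    forall P, 0 < P -> g P - g 0 <= 4 / (1 - 2 * q) * (xi `^ q) ^+ 2 / xi].
Proof.
move=> q2 q0 xi0 xi1; pose a := 1 - 2 * q.
have a0 : 0 < a by rewrite /a; lra.
pose c := 4 / a * (xi `^ q) ^+ 2 / xi.
have c0 : 0 < c by rewrite /c !mulr_gt0 ?invr_gt0 ?exprn_gt0 ?powR_gt0.
pose w t := xi * (1 + t).
have w0 t : -1 < t -> 0 < w t by move=> t1; rewrite mulr_gt0 //; lra.
exists (fun t => c * ratio_pow a (w t)),
  (fun t => c * (a * (w t / (1 + w t)) `^ (a - 1) * ((1 + w t) ^+ 2)^-1 * xi)).
split.
- move=> t /w0 wt; have Dw : is_derive t 1 w xi.
    by apply: is_derive_eq; rewrite /GRing.scale /=; ring.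
  have Dr := is_derive_ratio_pow a wt.
  have D := @is_derive1_comp _ (ratio_pow a) w t _ _ Dr Dw.
  exact: (@is_deriveZ _ _ _ (ratio_pow a \o w) c).
- move=> t t0; have wt : 0 < w t by apply: w0; lra.
  have t1 : 0 < 1 + t by lra.
  have aE : a - 1 = - q + - q by rewrite /a; ring.
  have h1 : xi `^ (a - 1) * ((1 + t) `^ (- q)) ^+ 2 <= (w t / (1 + w t)) `^ (a - 1).
    apply: le_trans (ratio_ge _ wt); last by rewrite aE; lra.
    rewrite /w powRM ?(ltW xi0) ?(ltW t1) // ler_wpM2l ?powR_ge0 //.
    by rewrite aE powRD ?expr2 // (gt_eqF t1) implybT.
  have h2 : 4^-1 * expR (- (xi * t)) ^+ 2 <= ((1 + w t) ^+ 2)^-1.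
    rewrite expRN exprVn -invfM lef_pV2 ?posrE ?mulr_gt0 ?exprn_gt0 ?expR_gt0 ?addr_gt0 //.
    have -> : 4 * expR (xi * t) ^+ 2 = (2 * expR (xi * t)) ^+ 2 by ring.
    rewrite ler_pXn2r ?nnegrE ?mulr_ge0 ?expR_ge0 ?addr_ge0 ?(ltW wt) //.
    have := expR_ge1Dx (xi * t); have : 0 <= xi * t by rewrite mulr_ge0 ?ltW.
    by rewrite /w; lra.
  apply: (@le_trans _ _ (c * a * xi * (xi `^ (a - 1) * ((1 + t) `^ (- q)) ^+ 2 *
      (4^-1 * expR (- (xi * t)) ^+ 2)))).
    (* [c] is calibrated so that this factor cancels the [4^-1] of [h2]. *)
    have e : c * a * xi * xi `^ (a - 1) = 4.
      rewrite aE powRD; last by rewrite (gt_eqF xi0) implybT.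
      rewrite powRN /c; field.
      by rewrite !gt_eqF ?powR_gt0.
    rewrite le_eqVlt; apply/orP; left; apply/eqP.
    by rewrite !mulrA e exprMn; field.
  rewrite [leRHS](_ : _ = c * a * xi *
      ((w t / (1 + w t)) `^ (a - 1) * ((1 + w t) ^+ 2)^-1)); last by ring.
  apply: ler_wpM2l; first exact: ltW (mulr_gt0 (mulr_gt0 c0 a0) xi0).
  by apply: ler_pM; rewrite // mulr_ge0 ?powR_ge0 ?invr_ge0 ?sqr_ge0.
- move=> P P0; rewrite -mulrBr -/c ler_piMr ?(ltW c0) //.
  have := @ratio_pow_le1 a (w P) (ltW a0) (w0 P (lt_trans (ltrN10 R) P0)).
  have := ratio_pow_ge0 a (w 0); rewrite /c -/a; lra.
Qed.

(** With w = eps s, the product s^(-theta) min(eps, 1/s) becomes eps^(1 + theta) w^(-theta) min(1,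
    1/w), which is w^(-theta) near 0 and w^(-theta - 1) at infinity up to the power of eps. [G] is a
    sum of one function of each kind with an explicit primitive; integrating with ds = dw / eps
    leaves eps^theta. *)
Lemma balakrishnan_majorant theta : 0 < theta -> theta < 1 ->
  exists2 B : R, 0 < B & forall eps : R, 0 < eps -> exists2 G : R -> R,
    forall s, 0 < s -> s `^ (- theta) * Num.min eps s^-1 <= G s /\ 0 <= G s &
    (\int[lebesgue_measure]_(s in `]0%R, +oo[) (G s)%:E <= (B * eps `^ theta)%:E)%E.
Proof.
move=> th0 th1; pose a := 1 - theta; have a0 : 0 < a by rewrite /a; lra.
exists (4 * (a^-1 + theta^-1)); first by rewrite mulr_gt0 // addr_gt0 ?invr_gt0.
move=> eps eps0; pose k := 4 * eps `^ theta.
have k0 : 0 < k by rewrite mulr_gt0 // powR_gt0.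
pose w s := eps * s.
have w0 s : 0 < s -> 0 < w s by move=> s0; rewrite mulr_gt0.
pose G s := k * eps * ((w s / (1 + w s)) `^ (a - 1) * ((1 + w s) ^+ 2)^-1
   + (1 + w s) `^ (- theta - 1)).
pose F s := k * (a^-1 * ratio_pow a (w s) - theta^-1 * (1 + w s) `^ (- theta)).
have G0 s : 0 < s -> 0 <= G s.
  move=> s0; apply: mulr_ge0; first exact: ltW (mulr_gt0 k0 eps0).
  by rewrite addr_ge0 ?powR_ge0 // mulr_ge0 ?powR_ge0 // invr_ge0 sqr_ge0.
exists G.
  move=> s s0; split; last exact: G0.
  have ws := w0 _ s0.
  have aE : a - 1 = - theta by rewrite /a; ring.
  have -> : s `^ (- theta) * Num.min eps s^-1 =
     eps `^ theta * eps * ((w s) `^ (- theta) * Num.min 1 (w s)^-1).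
    have -> : Num.min eps s^-1 = eps * Num.min 1 (w s)^-1.
      rewrite minr_pMr ?(ltW eps0) // mulr1 /w invfM mulrA mulfV ?mul1r // gt_eqF //.
    rewrite /w powRM ?ltW //.
    have : eps `^ theta * eps `^ (- theta) = 1.
      by rewrite powRN mulfV // gt_eqF // powR_gt0.
    by move=> e; rewrite -[LHS]mul1r -e; ring.
  rewrite [leRHS](_ : _ = eps `^ theta * eps *
     (4 * ((w s / (1 + w s)) `^ (a - 1) * ((1 + w s) ^+ 2)^-1 + (1 + w s) `^ (- theta - 1))));
    last by rewrite /G /k; ring.
  rewrite ler_pM2l ?mulr_gt0 ?powR_gt0 // aE.
  have p1 : 0 <= (w s / (1 + w s)) `^ (- theta) * ((1 + w s) ^+ 2)^-1.
    by rewrite mulr_ge0 ?powR_ge0 // invr_ge0 sqr_ge0.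
  have p2 : 0 <= (1 + w s) `^ (- theta - 1) by exact: powR_ge0.
  (* The factor 4 covers both cases: (1 + w)^2 <= 4 for w <= 1, and (1 + w)^(theta + 1) <= (2
     w)^(theta + 1) <= 4 w^(theta + 1) otherwise. *)
  have [ws1|ws1] := leP (w s) 1.
    apply: (@le_trans _ _ ((w s) `^ (- theta))).
      by rewrite ler_piMr ?powR_ge0 // ge_min lexx.
    suff : (w s) `^ (- theta) <= 4 * ((w s / (1 + w s)) `^ (- theta) * ((1 + w s) ^+ 2)^-1) by lra.
    apply: le_trans (ratio_ge _ ws) _; first by lra.
    rewrite mulrCA ler_peMr ?powR_ge0 // -ler_pdivrMl // mulr1.
    rewrite lef_pV2 ?posrE ?exprn_gt0 ?addr_gt0 //; nra.
  apply: (@le_trans _ _ ((w s) `^ (- theta - 1))).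
    have -> : (w s) `^ (- theta - 1) = (w s) `^ (- theta) * (w s)^-1.
      by rewrite powRD ?powR_inv1 ?(gt_eqF ws) ?implybT // ltW.
    by rewrite ler_wpM2l ?powR_ge0 // ge_min lexx orbT.
  suff : (w s) `^ (- theta - 1) <= 4 * (1 + w s) `^ (- theta - 1) by lra.
  have h1 : (2 * w s) `^ (- theta - 1) <= (1 + w s) `^ (- theta - 1).
    by apply: powR_antitone; lra.
  have h2 : 4^-1 <= 2 `^ (- theta - 1) :> R.
    have -> : 4^-1 = 2 `^ (- 2%:R) :> R by rewrite powRN powR_mulrn // expr2; congr (_^-1); ring.
    rewrite ler_powR //; lra.
  rewrite powRM ?(ltW ws) // in h1.
  have h3 : 4^-1 * w s `^ (- theta - 1) <= (1 + w s) `^ (- theta - 1).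
    by apply: le_trans h1; rewrite ler_wpM2r ?powR_ge0.
  by lra.
have cw s : {for s, continuous w}.
  by apply: is_derive_continuous; apply: is_derive_eq.
have c1w s : {for s, continuous (fun s => 1 + w s)}.
  by apply: cvgD; [exact: cvg_cst|exact: cw].
apply: (@integral_pos_line_le _ F G).
- move=> s s0; have ws := w0 _ s0; have ws1 : 0 < 1 + w s by rewrite addr_gt0.
  have i1 : {for s, continuous (fun s => (1 + w s)^-1)}.
    by apply: cvgV; [rewrite gt_eqF|exact: c1w].
  apply: cvgM; first exact: cvg_cst.
  apply: cvgD; [apply: cvgM|].
  + apply: (@continuous_comp _ _ _ (fun s => w s / (1 + w s)) (@powR R ^~ (a - 1))).
      by apply: cvgM; [exact: cw|exact: i1].
    by apply: continuous_powR; rewrite divr_gt0.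
  + apply: cvgV; first by rewrite gt_eqF // exprn_gt0.
    by rewrite expr2; under eq_fun do rewrite expr2; apply: cvgM; exact: c1w.
  + apply: (@continuous_comp _ _ _ (fun s => 1 + w s) (@powR R ^~ (- theta - 1))).
      exact: c1w.
    exact: continuous_powR.
- exact: G0.
- move=> s s0; have ws := w0 _ s0; have ws1 : 0 < 1 + w s by rewrite addr_gt0.
  have Dw : is_derive s 1 w eps.
    by apply: is_derive_eq; rewrite /GRing.scale /=; ring.
  have Dw1 : is_derive s 1 (fun s => 1 + w s) eps.
    by apply: is_derive_eq; rewrite /GRing.scale /=; ring.
  have D1 := @is_derive1_comp _ (ratio_pow a) w s _ _ (is_derive_ratio_pow a ws) Dw.
  have D2 := @is_derive1_comp _ (@powR R ^~ (- theta)) (fun s => 1 + w s) s _ _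
    (is_derive1_powR (- theta) ws1) Dw1.
  have D3 := @is_deriveB _ _ _ _ _ _ _ _ _ (@is_deriveZ _ _ _ _ a^-1 _ _ _ D1)
                            (@is_deriveZ _ _ _ _ theta^-1 _ _ _ D2).
  have D4 := @is_deriveZ _ _ _ _ k _ _ _ D3.
  apply: (is_derive_eq D4); rewrite /G /GRing.scale /=.
  by field; rewrite !gt_eqF.
- move=> x y x0 xy; have y0 := lt_trans x0 xy; rewrite /F -mulrBr /k.
  have h1 := @ratio_pow_le1 a (w y) (ltW a0) (w0 _ y0).
  have h2 := ratio_pow_ge0 a (w x).
  have h3 : 0 <= (1 + w y) `^ (- theta) := powR_ge0 _ _.
  have h4 : (1 + w x) `^ (- theta) <= 1.
    rewrite [leRHS](_ : 1 = 1 `^ (- theta)); last by rewrite powR1.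
    apply: powR_antitone => //; first by lra.
    by rewrite lerDl ltW // w0.
  rewrite [leRHS](_ : _ = 4 * eps `^ theta * (a^-1 + theta^-1)); last by ring.
  rewrite ler_pM2l ?mulr_gt0 ?powR_gt0 //.
  have ai : 0 < a^-1 by rewrite invr_gt0.
  have ti : 0 < theta^-1 by rewrite invr_gt0.
  have := ler_wpM2l (ltW ai) h1; have := ler_wpM2l (ltW ti) h4.
  have := mulr_ge0 (ltW ai) h2; have := mulr_ge0 (ltW ti) h3; lra.
Qed.

End PowerCalculus.

(** * Decay of orbits on the ranges of negative powers *)

Section NegativePowers.
Variables (R : realType) (H : completeNormedModType R[i]).
Variable ip : {dot H for @conjc R}.
Hypothesis ip_norm : forall x : H, `|x| ^+ 2 = ip x x.
Local Notation rip := (rip ip).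
Variables (beta : R) (T : R -> {linear H -> H}) (A : unbounded_op H).
Hypotheses (beta0 : 0 < beta)
  (T_C0 : C0_semigroup T) (T_gen : generator T (opp_op A)).
Variables K C : R.
Hypotheses (K1 : 1 <= K)
  (TK : forall t x, 0 <= t -> rnorm (T t x) <= K * rnorm x)
  (C0 : 0 < C)
  (TC : forall t v w, 0 <= t -> right_deriv (evenext T) v (- w) ->
     rnorm (T t v) <= C * rate beta t * rnorm w).

Let K0 : 0 < K. Proof. exact: lt_le_trans K1. Qed.
Let SK := evenext_semigroup T_C0 TK.

Lemma right_deriv_orbit s v w : 0 <= s -> right_deriv (evenext T) v w ->
  right_deriv (evenext T) (T s v) (T s w).
Proof.
move=> s0 vw e e0; have e0' : 0 < e / K by rewrite divr_gt0.
near=> t; have t0 : 0 < t by near: t; exact: nbhs_right_gt.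
have h : rnorm (evenext T t v - v - t%:C *: w) <= e / K * t by near: t; exact: vw.
have -> : evenext T t (T s v) - T s v - t%:C *: T s w = T s (evenext T t v - v - t%:C *: w).
  have [_ _ TD _] := T_C0.
  have TZ : T s (t%:C *: w) = t%:C *: T s w by rewrite linearZ.
  rewrite !linearB TZ /evenext gtr0_norm //; congr (_ - _ - _).
  by rewrite -!TD ?(ltW t0) // (addrC s).
apply: le_trans (TK _ s0) _; rewrite -ler_pdivlMl //.
by apply: le_trans h _; rewrite le_eqVlt; apply/orP; left; apply/eqP; field; rewrite gt_eqF.
Unshelve. all: by end_near.
Qed.

(** The second case is the default value of [inv_op] when [u] has no preimage; decay estimates hold
    trivially there. *)
Lemma inv_op_right_deriv u :
  right_deriv (evenext T) (inv_op A u) (- u) \/ inv_op A u = 0.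
Proof.
rewrite /inv_op; case: xgetP => [v _ /= hv|]; last by right.
by left; apply/(generator_right_deriv T_gen).
Qed.

(** Each application of the inverse consumes a piece of time [t] and contributes one factor of the
    rate; the time [s] is left for [u] itself. *)
Lemma inv_op_iter_decay n s t u : 0 <= s -> 0 <= t ->
  rnorm (T (n%:R * t + s) (iter n (inv_op A) u)) <= (C * rate beta t) ^+ n * rnorm (T s u).
Proof.
move=> s0 t0; elim: n => [|n IH]; first by rewrite mul0r add0r expr0 mul1r.
have [_ _ TD _] := T_C0.
have tau0 : 0 <= n%:R * t + s by rewrite addr_ge0 // mulr_ge0.
have -> : n.+1%:R * t + s = t + (n%:R * t + s) by rewrite -natr1; ring.
rewrite TD // exprS -mulrA iterS.
have r0 : 0 <= C * rate beta t by rewrite mulr_ge0 ?(ltW C0) // ltW // rate_gt0.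
case: (inv_op_right_deriv (iter n (inv_op A) u)) => [h|->].
  have := right_deriv_orbit tau0 h; rewrite linearN => /(TC t0) /le_trans; apply.
  by rewrite ler_wpM2l.
by rewrite !linear0 rnorm0 mulr_ge0 // mulr_ge0 ?exprn_ge0 ?rnorm_ge0.
Qed.

(** With v = (s + A)^-1 x, the bound by 1/s is that of the resolvent, and the bound by the rate
    comes from A v = x - s v, whose norm is at most (1 + 2 K) |x|. *)
Lemma orbit_resolvent_min s t x : 0 < s -> 0 <= t ->
  rnorm (T t (res s%:C A x)) <=
  (C * (1 + 2 * K) + 2 * K ^+ 2) * Num.min (rate beta t) s^-1 * rnorm x.
Proof.
move=> s0 t0; rewrite real_axisE; set v := res _ A x.
have x0 := rnorm_ge0 x; have r0 := rate_gt0 beta t0.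
have vb : rnorm v <= 2 * K / s * rnorm x by exact: (resolvent_bound ip_norm T_C0 T_gen K1 TK 0 x s0).
have h1 : rnorm (T t v) <= C * rate beta t * ((1 + 2 * K) * rnorm x).
  have /(right_deriv_rescaleE ip_norm) := resolvent_deriv ip_norm T_C0 T_gen K1 TK 0 x s0.
  rewrite -/v -[- x + _]opprK opprD opprK -real_axisE => /(TC t0)/le_trans; apply.
  rewrite ler_wpM2l ?mulr_ge0 ?(ltW C0) ?(ltW r0) //.
  apply: le_trans (rnormB _ _) _; rewrite rnormZr gtr0_norm //.
  have : s * rnorm v <= 2 * K * rnorm x.
    by rewrite -ler_pdivlMl //; rewrite [leRHS](_ : _ = 2 * K / s * rnorm x) //; ring.
  lra.
have h2 : rnorm (T t v) <= 2 * K ^+ 2 * s^-1 * rnorm x.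
  apply: le_trans (TK _ t0) _; apply: le_trans (ler_wpM2l (ltW K0) vb) _.
  by rewrite le_eqVlt; apply/orP; left; apply/eqP; ring.
have k1 : 0 <= C * (1 + 2 * K) by rewrite mulr_ge0 ?(ltW C0) // addr_ge0 // mulr_ge0 // ltW.
have k2 : 0 <= 2 * K ^+ 2 by rewrite mulr_ge0 // sqr_ge0.
have si : 0 < s^-1 by rewrite invr_gt0.
have [rs|rs] := leP (rate beta t) s^-1.
  apply: le_trans h1 _; rewrite mulrA ler_wpM2r // mulrAC ler_wpM2r ?(ltW r0) //.
  by rewrite lerDl.
by apply: le_trans h2 _; rewrite ler_wpM2r // ler_wpM2r ?(ltW si) // lerDr.
Qed.

(** The integral formula is available only weakly, so [T t] is moved onto [y] by its adjoint and
    back onto the resolvent inside the integral; the majorant is then used with [eps] equal to the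
    rate. *)
Lemma balakrishnan_decay theta : 0 < theta -> theta < 1 -> exists2 B : R, 0 < B &
  forall t x, 0 <= t ->
    rnorm (T t (balakrishnan ip theta A x)) <= B * rate beta t `^ theta * rnorm x.
Proof.
move=> th0 th1; have [B B0 hB] := balakrishnan_majorant th0 th1.
pose D := C * (1 + 2 * K) + 2 * K ^+ 2.
have D0 : 0 < D.
  by rewrite addr_gt0 ?mulr_gt0 ?exprn_gt0 // addr_gt0 // mulr_gt0.
exists (D * B); first exact: mulr_gt0.
move=> t x t0; rewrite /balakrishnan /riesz; case: xgetP => [u _ /= hu|_]; last first.
  by rewrite linear0 rnorm0 !mulr_ge0 ?powR_ge0 ?rnorm_ge0 ?ltW.
have r0 := rate_gt0 beta t0.
apply: (rnorm_le_rip ip_norm).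
  by rewrite !mulr_ge0 ?powR_ge0 ?rnorm_ge0 ?ltW.
move=> y.
have [||y' hy'] := @adjoint_exists _ _ _ ip_norm (T t) K _ _ (fun x => TK x t0) y.
- by move=> a b; rewrite linearD.
- by move=> a b; rewrite linearZ.
rewrite hy' /rip hu ReM_real /cintegral [complex.Re (_ +i* _)]/=.
set I := Rintegral _ _ _.
have [G GG IG] := hB _ r0.
pose k := D * rnorm x * rnorm y.
have k0 : 0 <= k by rewrite !mulr_ge0 ?rnorm_ge0 ?ltW.
have hI : `|I| <= k * (B * rate beta t `^ theta).
  rewrite -lee_fin; apply: (le_trans (@abs_Rintegral_le _ _ _ lebesgue_measure `]0, +oo[%classic _
    (fun s => (k * G s)%:E) _)).
    move=> s; rewrite /= in_itv /= andbT => s0; rewrite lee_fin.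
    have [g1 g2] := GG _ s0.
    rewrite ReM_real normrM ger0_norm ?powR_ge0 // -[complex.Re _]/(rip _ _) -hy'.
    have h1 := rip_CauchySchwarz ip_norm (T t (res s%:C A x)) y.
    have h2 := ler_wpM2r (rnorm_ge0 y) (orbit_resolvent_min x s0 t0).
    apply: le_trans (ler_wpM2l (powR_ge0 _ _) (le_trans h1 h2)) _.
    rewrite [leLHS](_ : _ = k * (s `^ (- theta) * Num.min (rate beta t) s^-1)).
      by rewrite ler_wpM2l.
    by rewrite /k /D; ring.
  under eq_integral do rewrite EFinM.
  apply: le_trans (ge0_integral_scale_le _ k0 _) _.
    by move=> s; rewrite /= in_itv /= andbT lee_fin => /GG[].
  by rewrite [leRHS]EFinM; apply: lee_wpmul2l => //; rewrite lee_fin.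
have sp : `|sin (pi * theta) / pi| <= 1.
  have pi1 : 1 <= pi :> R by have := pi_ge2 R; lra.
  rewrite normrM normfV (ger0_norm (pi_ge0 R)) ler_pdivrMr ?pi_gt0 // mul1r.
  by apply: le_trans pi1; rewrite ler_norml sin_geN1 sin_le1.
apply: le_trans (ler_norm _) _; rewrite normrM.
apply: le_trans (ler_pM _ _ sp hI) _ => //.
by rewrite mul1r /k le_eqVlt; apply/orP; left; apply/eqP; ring.
Qed.

(** The time [t] is cut into n + 1 equal pieces [s], one for each factor of the inverse and one for
    the fractional part. The exponents add up to beta q / beta = q, and 1 + t <= (1 + n) (1 + s)
    accounts for the constant (1 + n)^q. *)
Lemma neg_power_decay q : 0 < q -> exists2 B : R, 0 < B &
  forall t x, 0 <= t ->
    rnorm (T t (neg_power ip (beta * q) A x)) <= B * (1 + t) `^ (- q) * rnorm x.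
Proof.
move=> q0; set alpha := beta * q.
have al0 : 0 < alpha by rewrite mulr_gt0.
rewrite /neg_power; set n := Num.truncn alpha; set theta := alpha - n%:R.
have /andP[n1 n2] := truncn_itv (ltW al0).
have th0 : 0 <= theta by rewrite subr_ge0.
have th1 : theta < 1 by rewrite ltrBlDr addrC natr1.
have [B B0 hB] : exists2 B : R, 0 < B & forall t x, 0 <= t ->
    rnorm (T t (if theta == 0 then x else balakrishnan ip theta A x)) <=
      B * rate beta t `^ theta * rnorm x.
  case: eqVneq => [->|thN0].
    by exists K => // t x t0; rewrite powRr0 mulr1 TK.
  by apply: balakrishnan_decay => //; rewrite lt_neqAle eq_sym thN0.
have n0 : 0 < 1 + n%:R :> R by rewrite ltr_pwDl.
exists (C ^+ n * B * (1 + n%:R) `^ q).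
  by rewrite !mulr_gt0 ?exprn_gt0 ?powR_gt0.
move=> t x t0; pose s := t / (1 + n%:R).
have s0 : 0 <= s by rewrite divr_ge0 // ltW.
have r0 := rate_gt0 beta s0.
have tE : t = n%:R * s + s.
  by rewrite -[X in _ + X]mul1r -mulrDl addrC /s mulrC divfK // gt_eqF.
rewrite {1}tE; apply: le_trans (inv_op_iter_decay _ _ s0 s0) _.
apply: le_trans (ler_wpM2l _ (hB s x s0)) _.
  by rewrite exprn_ge0 // mulr_ge0 ?(ltW C0) ?(ltW r0).
rewrite exprMn mulrA ler_wpM2r ?rnorm_ge0 //.
have -> : C ^+ n * rate beta s ^+ n * (B * rate beta s `^ theta) =
    C ^+ n * B * (1 + s) `^ (- q).
  rewrite -[LHS]/(_ * _ * (_ * _)) mulrACA; congr (_ * _).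
  rewrite -powR_mulrn ?(ltW r0) // -powRD; last by rewrite (gt_eqF r0) implybT.
  rewrite /rate -powRrM; congr (_ `^ _).
  rewrite /theta addrC subrK /alpha; field; by rewrite gt_eqF.
rewrite -[leRHS]mulrA ler_wpM2l ?mulr_ge0 ?exprn_ge0 ?(ltW C0) ?(ltW B0) //.
have s1 : 0 < 1 + s by rewrite ltr_pwDl.
have t1 : 0 < 1 + t by rewrite ltr_pwDl.
rewrite !powRN ler_pdivlMr ?powR_gt0 // mulrC ler_pdivrMr ?powR_gt0 // -powRM ?(ltW n0) ?(ltW s1) //.
apply: ge0_ler_powR; rewrite ?nnegrE ?(ltW q0) ?mulr_ge0 ?(ltW n0) ?(ltW s1) ?(ltW t1) //.
by rewrite mulrDr mulr1 (_ : (1 + n%:R) * s = t) ?lerD2r ?lerDl // /s mulrC divfK // gt_eqF.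
Qed.

End NegativePowers.

(** * The kernel estimate and the theorem *)

Section KernelBound.
Variables (R : realType) (H : completeNormedModType R[i]).
Variable ip : {dot H for @conjc R}.
Hypothesis ip_norm : forall x : H, `|x| ^+ 2 = ip x x.
Local Notation rip := (rip ip).
Variables (T : R -> {linear H -> H}) (A : unbounded_op H).
Hypotheses (T_C0 : C0_semigroup T) (T_gen : generator T (opp_op A)).
Variable K : R.
Hypotheses (K1 : 1 <= K)
  (TK : forall t x, 0 <= t -> rnorm (T t x) <= K * rnorm x).

Let K0 : 0 < K. Proof. exact: lt_le_trans K1. Qed.

Lemma ip_CauchySchwarz (x y : H) : complex.Re `|ip x y| <= rnorm x * rnorm y.
Proof.
have [th th1 <-] := unimodular_phase (ip x y).
have -> : complex.Re (th * ip x y) = rip (th *: x) y by rewrite /rip linearZl_LR.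
by apply: le_trans (rip_le ip_norm _ _) _; rewrite rnormZ th1 mul1r.
Qed.

Lemma resolvent_sqr_continuous xi (u y : H) : 0 < xi ->
  continuous (fun eta : R =>
    complex.Re `|ip (res (xi -i* eta) A (res (xi -i* eta) A u)) y|).
Proof.
move=> xi0; pose b := 2 * K / xi.
have b0 : 0 <= b by rewrite divr_ge0 ?mulr_ge0 // ltW.
(* The difference of squares is split as R(s) (R(s) - R(t)) + (R(s) - R(t)) R(t), each half being
   bounded by b^3 |s - t| |u|. *)
pose L := 2 * b ^+ 3 * rnorm u * rnorm y.
have L0 : 0 <= L.
  apply: mulr_ge0; last exact: rnorm_ge0.
  apply: mulr_ge0; last exact: rnorm_ge0.
  by apply: mulr_ge0 => //; exact: exprn_ge0.
have lip (s t : R) : complex.Re `|ip (res (xi -i* s) A (res (xi -i* s) A u)) y|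
   - complex.Re `|ip (res (xi -i* t) A (res (xi -i* t) A u)) y| <= L * `|s - t|.
  set z := ip _ y; set w := ip _ y.
  have := Re_normD (z - w) w; rewrite subrK -lerBlDr => /le_trans; apply.
  have -> : z - w = ip (res (xi -i* s) A (res (xi -i* s) A u)
                        - res (xi -i* t) A (res (xi -i* t) A u)) y.
    by rewrite linearBl.
  apply: le_trans (ip_CauchySchwarz _ _) _.
  rewrite /L (mulrAC _ (rnorm y)) ler_wpM2r ?rnorm_ge0 //.
  apply: le_trans (rnorm_tri _ (res (xi -i* s) A (res (xi -i* t) A u)) _) _.
  rewrite -(resolventB ip_norm T_C0 T_gen K1 TK _ _ _ xi0).
  have h1 := resolvent_bound ip_norm T_C0 T_gen K1 TK s
    (res (xi -i* s) A u - res (xi -i* t) A u) xi0.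
  have h2 := resolvent_lipschitz ip_norm T_C0 T_gen K1 TK s t u xi0.
  have h3 := resolvent_lipschitz ip_norm T_C0 T_gen K1 TK s t (res (xi -i* t) A u) xi0.
  have h4 := resolvent_bound ip_norm T_C0 T_gen K1 TK t u xi0.
  rewrite -/b in h1 h2 h3 h4.
  have h5 := le_trans h1 (ler_wpM2l b0 h2).
  have h6 : b ^+ 2 * rnorm (res (xi -i* t) A u) * `|s - t| <=
      b ^+ 2 * (b * rnorm u) * `|s - t|.
    by rewrite ler_wpM2r // ler_wpM2l ?exprn_ge0.
  apply: le_trans (lerD h5 (le_trans h3 h6)) _.
  by rewrite le_eqVlt; apply/orP; left; apply/eqP; ring.
move=> t; apply/cvgrPdist_le => e e0.
have d0 : 0 < e / (L + 1) by rewrite divr_gt0 // ltr_wpDl.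
exists (e / (L + 1)) => // s /= ts.
have Lts : L * `|t - s| <= e.
  apply: (@le_trans _ _ ((L + 1) * `|t - s|)); first by rewrite ler_wpM2r // lerDl.
  by rewrite -ler_pdivlMl ?ltr_wpDl // mulrC ltW.
rewrite ler_norml; apply/andP; split; last exact: le_trans (lip _ _) Lts.
by rewrite lerNl opprB; apply: le_trans (lip _ _) _; rewrite distrC.
Qed.

Lemma psi_gt0 (q xi : R) : 0 < xi -> 0 < psi q xi.
Proof. by move=> xi0; rewrite /psi; case: ifP => // _; rewrite powR_gt0. Qed.

(** For xi >= 1 the weight is 1 and the exponential decides: its square integrates to 1 / (2 xi). *)
Lemma damped_decay_primitive (q xi : R) : 0 < q -> q < 1 / 2 -> 0 < xi ->
  exists g dg : R -> R, [/\ forall t : R, -1 < t -> is_derive t 1 g (dg t),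
    forall t, 0 < t -> (expR (- (xi * t)) * (1 + t) `^ (- q)) ^+ 2 <= dg t &
    forall P, 0 < P -> g P - g 0 <= 4 / (1 - 2 * q) * psi q xi ^+ 2 / xi].
Proof.
move=> q0 q2 xi0; rewrite /psi; case: ltP => xi1.
  by apply: damped_power_primitive => //; exact: ltW.
exists (fun t => - ((2 * xi)^-1 * expR (- (2 * xi * t)))), (fun t => expR (- (2 * xi * t))).
split.
- move=> t _; apply: is_derive_eq; rewrite /GRing.scale /=.
  by field; rewrite gt_eqF.
- move=> t t0; rewrite exprMn [leRHS](_ : _ = expR (- (xi * t)) ^+ 2); last first.
    by rewrite expr2 -expRD; congr expR; ring.
  rewrite ler_piMr ?sqr_ge0 // expr_le1 ?powR_ge0 //.
  rewrite powRN invf_le1 ?powR_gt0 //; last by rewrite addr_gt0.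
  rewrite [leLHS](_ : 1 = (1 : R) `^ q); last by rewrite powR1.
  by apply: ge0_ler_powR; rewrite ?nnegrE ?(ltW q0) // ?lerDl ?addr_ge0 ?(ltW t0).
- move=> P P0; rewrite mulr0 oppr0 expR0 mulr1 expr1n mulr1 opprK.
  have c1 : 2^-1 <= 4 / (1 - 2 * q) by rewrite ler_pdivlMr; lra.
  have xii : 0 < xi^-1 by rewrite invr_gt0.
  have := ler_wpM2r (ltW xii) c1; rewrite -invfM.
  have : 0 <= (2 * xi)^-1 * expR (- (2 * xi * P)).
    by rewrite mulr_ge0 ?expR_ge0 // invr_ge0 mulr_ge0 // ltW.
  lra.
Qed.

Lemma kernel_bound (q xi B : R) (u y : H) : 0 < q -> q < 1 / 2 -> 0 < xi -> 0 < B ->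
  (forall t, 0 <= t -> rnorm (T t u) <= B * (1 + t) `^ (- q)) ->
  (\int[lebesgue_measure]_(eta in [set: R])
     (complex.Re `|ip (res (xi -i* eta) A (res (xi -i* eta) A u)) y|)%:E
   <= (2 * pi * (K * (2^-1 + 4 * B ^+ 2 * (4 / (1 - 2 * q)))) * (psi q xi / xi) * rnorm y)%:E)%E.
Proof.
move=> q0 q2 xi0 B0 Tu.
have [P P0 hP] := damped_half K1 xi0.
pose h := 2 * pi / P.
have h0 : 0 < h by rewrite divr_gt0 ?mulr_gt0 ?pi_gt0.
have hper : cis (h * P) = 1 by rewrite /h divfK ?gt_eqF // cis_2pi.
have [g [dg [Dg hg hJ]]] := damped_decay_primitive q0 q2 xi0.
have p0 := psi_gt0 q xi0.
set c1 := 4 / (1 - 2 * q).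
(* The output of [resolvent_sqr_sum] at [s = psi q xi]; its factor [P] cancels against the one in
   [h]. *)
pose W := P * (K * (psi q xi / (2 * xi) +
  4 * (B ^+ 2 * (c1 * psi q xi ^+ 2 / xi)) / psi q xi)) * rnorm y.
have -> : 2 * pi * (K * (2^-1 + 4 * B ^+ 2 * c1)) * (psi q xi / xi) * rnorm y = h * W.
  by rewrite /h /W; field; rewrite !gt_eqF.
apply: (integral_line_le_translates h0).
- exact: resolvent_sqr_continuous.
- by move=> s; rewrite normc_def /= sqrtr_ge0.
move=> m s.
have Dg' (t : R) : -1 < t -> is_derive t 1 (fun t => B ^+ 2 * g t) (B ^+ 2 * dg t).
  by move=> t1; have ? := Dg t t1; apply: is_derive_eq.
have hg' (t : R) : 0 < t -> (expR (- (xi * t)) * rnorm (T t u)) ^+ 2 <= B ^+ 2 * dg t.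
  move=> t0; apply: le_trans (ler_wpM2l (sqr_ge0 B) (hg t t0)).
  rewrite -exprMn ler_pXn2r ?nnegrE ?mulr_ge0 ?expR_ge0 ?rnorm_ge0 ?powR_ge0 ?(ltW B0) //.
  by rewrite mulrCA ler_wpM2l ?expR_ge0 // Tu // ltW.
apply: le_trans (@resolvent_sqr_sum _ _ _ ip_norm _ _ T_C0 T_gen _ K1 TK _ _ _ xi0 P0 hP
  (lt0r_neq0 h0) hper m s (psi q xi) u y _ _ p0 Dg' hg') _.
rewrite /W ler_wpM2r ?rnorm_ge0 // ler_pM2l // ler_pM2l // lerD2l.
rewrite ler_pM2r ?invr_gt0 // ler_pM2l // -mulrBr ler_wpM2l ?sqr_ge0 //.
exact: hJ.
Qed.

End KernelBound.

Theorem proposition2p3 (R : realType) (H : completeNormedModType R[i])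
    (ip : {dot H for @conjc R}) (ip_norm : forall x : H, `|x| ^+ 2 = ip x x)
    (beta : R) (beta_gt0 : 0 < beta)
    (T : R -> {linear H -> H}) (A : unbounded_op H)
    (T_C0 : C0_semigroup T) (T_gen : generator T (opp_op A))
    (T_stable : polynomially_stable beta T A) :
  forall q : R, 0 < q -> q < 1 / 2 ->
  exists M : R, 0 < M /\
    forall f : R[i]^o -> R[i]^o, in_B f ->
      (opnorm (Bcalc ip f A \o neg_power ip (beta * q) A)
       <= opnorm (neg_power ip (beta * q) A) * (rnorm (f_infty f))%:E
          + M%:E * normB0q q f)%E.
Proof.
move=> q q0 q2.
have [K K1 TK] := semigroup_bound T_stable.
have [C C0 hC] := orbit_range_decay ip_norm beta_gt0 T_C0 T_gen T_stable K1 TK.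
have [B B0 hB] := neg_power_decay ip_norm beta_gt0 T_C0 T_gen K1 TK C0
  (fun t v w t0 vw => proj1 (hC t v w t0 vw)) q0.
pose M := 2 * pi * (K * (2^-1 + 4 * B ^+ 2 * (4 / (1 - 2 * q)))).
have M0 : 0 < M.
  rewrite !mulr_gt0 ?pi_gt0 ?(lt_le_trans ltr01 K1) // addr_gt0 ?invr_gt0 //.
  by rewrite !mulr_gt0 ?exprn_gt0 // invr_gt0; lra.
exists M; split => // f _.
have S0 xi : (0 <= sup_deriv f xi)%E.
  apply: (@le_trans _ _ (rnorm (derive1 f (xi +i* 0)))%:E); first by rewrite lee_fin Re_norm_ge0.
  by apply: ereal_sup_ubound; exists 0.
have W0 : (0 <= normB0q q f)%E.
  apply: integral_ge0 => xi; rewrite /= in_itv /= andbT => xi0.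
  by rewrite mule_ge0 // lee_fin ltW // psi_gt0.
set nf := rnorm (f_infty f); have nf0 : 0 <= nf := Re_norm_ge0 _.
apply: opnorm_le => x x1 /=; set u := neg_power ip (beta * q) A x.
have op_u : ((rnorm u * nf)%:E <= opnorm (neg_power ip (beta * q) A) * nf%:E)%E.
  by rewrite EFinM lee_wpmul2r ?lee_fin // opnorm_ubound.
have Tu (t : R) : 0 <= t -> rnorm (T t u) <= B * (1 + t) `^ (- q).
  move=> t0; apply: le_trans (hB t x t0) _.
  by rewrite ler_piMr // mulr_ge0 ?powR_ge0 // ltW.
have rhs0 : (0 <= opnorm (neg_power ip (beta * q) A) * nf%:E + M%:E * normB0q q f)%E.
  apply: adde_ge0; last by rewrite mule_ge0 // lee_fin ltW.
  by apply: le_trans op_u; rewrite lee_fin mulr_ge0 ?rnorm_ge0.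
rewrite /Bcalc /riesz; case: xgetP => [U _ /= hU|_]; last by rewrite rnorm0.
have [NU0|NUN0] := eqVneq (rnorm U) 0; first by rewrite NU0.
have NU : 0 < rnorm U by rewrite lt_neqAle eq_sym NUN0 rnorm_ge0.
apply: (@le_trans _ _ ((rnorm u * nf)%:E + M%:E * normB0q q f)%E); last first.
  by rewrite leeD2r.
(* Testing the representation against [U] itself bounds the square of its norm; a factor [rnorm U]
   is cancelled at the end. *)
have := hU U; move=> /(congr1 (@complex.Re R)).
rewrite -[X in X = _]/(rip ip U U) (rip_norm ip_norm).
rewrite ReD; set I1 := complex.Re (ip _ U).
rewrite ReN ReM_real Re_cintegral.
set I := Rintegral _ _ _ => eU.
have hI1 : I1 <= rnorm u * nf * rnorm U.
  apply: le_trans (rip_le ip_norm _ _) _.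
  by rewrite rnormZ (mulrC (rnorm u)).
have hI : (`|I|%:E <= (M * rnorm U)%:E * normB0q q f)%E.
  apply: le_trans (ge0_integral_scale_le _ _ _); last 2 first.
  - by rewrite mulr_ge0 ?rnorm_ge0 // ltW.
  - move=> xi; rewrite /= in_itv /= andbT => xi0.
    by rewrite mule_ge0 // lee_fin ltW // psi_gt0.
  apply: (@abs_Rintegral_le _ _ _ lebesgue_measure) => xi hxi.
  have xi0 : 0 < xi by move: hxi; rewrite /= in_itv /= andbT.
  rewrite ReM_real Re_cintegral normrM (gtr0_norm xi0).
  set J := Rintegral _ _ _.
  have p0 := psi_gt0 q xi0.
  pose c eta := complex.Re `|ip (res (xi -i* eta) A (res (xi -i* eta) A u)) U|.
  have hJ : (`|J|%:E <= \int[lebesgue_measure]_(eta in [set: R]) (sup_deriv f xi * (c eta)%:E))%E.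
    apply: (@abs_Rintegral_le _ _ _ lebesgue_measure) => eta _.
    apply: (@le_trans _ _ ((rnorm (derive1 f (xi +i* eta)))%:E * (c eta)%:E)%E).
      rewrite -EFinM lee_fin; apply: le_trans (Re_le_norm _) _.
      by rewrite Re_normM mulrC.
    apply: lee_wpmul2r; first by rewrite lee_fin Re_norm_ge0.
    by apply: ereal_sup_ubound; exists eta.
  (* The supremum over [eta] may be infinite at some [xi]; the bound is then [+oo], as [psi q xi]
     and [M * rnorm U] are positive. *)
  have := S0 xi; move: hJ; case: (sup_deriv f xi) => [r| |] //.
    move=> hJ; rewrite lee_fin => r0.
    have := kernel_bound ip_norm T_C0 T_gen K1 TK U q0 q2 xi0 B0 Tu; rewrite -/M => hk.
    have hJ2 := le_trans hJ (ge0_integral_scale_le lebesgue_measure r0 _).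
    have {}hJ2 := le_trans (hJ2 _) (lee_wpmul2l _ hk).
    apply: (@le_trans _ _ (xi%:E * (r%:E * (M * (psi q xi / xi) * rnorm U)%:E))%E).
      rewrite EFinM lee_wpmul2l ?lee_fin ?(ltW xi0) //; apply: hJ2; last by rewrite lee_fin.
      by move=> eta _; rewrite lee_fin Re_norm_ge0.
    rewrite -!EFinM lee_fin le_eqVlt; apply/orP; left; apply/eqP.
    by field; rewrite gt_eqF.
  by move=> _ _; rewrite gt0_muley ?lte_fin // gt0_muley ?leey // lte_fin mulr_gt0.
move: hI W0; case: (normB0q q f) => [w| |] //; last first.
  by move=> _ _; rewrite gt0_muley ?lte_fin // addey // leey.
rewrite -!EFinM -EFinD !lee_fin => hI w0.
rewrite -(ler_pM2r NU) -expr2 eU.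
(* The prefactor of the calculus is at most 1, so [M] is the kernel constant as it stands. *)
have pi2 : 2 / pi <= 1 :> R by rewrite ler_pdivrMr ?pi_gt0 // mul1r pi_ge2.
have p0 : 0 <= 2 / pi :> R by rewrite divr_ge0 // pi_ge0.
have h1 : - (2 / pi * I) <= `|I|.
  apply: le_trans (ler_norm _) _; rewrite normrN normrM (ger0_norm p0).
  by rewrite ler_piMl.
rewrite [leRHS]mulrDl; apply: lerD => //.
by apply: le_trans h1 _; rewrite mulrAC.
Qed.
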